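(* Let $n,m\ge1$ and fix $f_1,f_2,\ldots,f_m\in\mathrm{QC}(\mathbb{R}^n)$. Then the function $F:(\mathbb{R}^+)^m\to[0,\infty]$ defined by $$F(\varepsilon_1,\varepsilon_2,\ldots,\varepsilon_m)=\int_{\mathbb{R}^n}\left[(\varepsilon_1\odot f_1)\oplus(\varepsilon_2\odot f_2)\oplus\cdots\oplus(\varepsilon_m\odot f_m)\right](x)\,dx$$ is a homogeneous polynomial of degree $n$ with non-negative coefficients (the coefficients being allowed to take the value $+\infty$).
   Context: $\mathrm{QC}(\mathbb{R}^n)$ denotes the class of functions $f:\mathbb{R}^n\to[0,\infty)$ that are quasi-concave, i.e. $f(\lambda x+(1-\lambda)y)\ge\min\{f(x),f(y)\}$ for all $x,y\in\mathbb{R}^n$, $0\le\lambda\le1$, and which moreover are upper semicontinuous, satisfy $\max_{x\in\mathbb{R}^n} f(x)=1$, and $f(x)\to0$ as $|x|\to\infty$. For $f,g\in\mathrm{QC}(\mathbb{R}^n)$: $(f\oplus g)(x)=\sup_{y+z=x}\min\{f(y),g(z)\}$; for $\lambda>0$, $(\lambda\odot f)(x)=f(x/\lambda)$; and $0\odot f=\mathbf{1}_{\{0\}}$, the indicator function of the origin. $\mathbb{R}^+=[0,\infty)$, and the convention $0\cdot\infty=0$ is used when evaluating the polynomial. Integrals are Lebesgue integrals with values in $[0,\infty]$. *)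

(* Defs.v *)
From HB Require Import structures.
From mathcomp Require Import all_boot all_order all_algebra.
From mathcomp Require Import all_classical all_reals all_analysis.

Set Implicit Arguments.
Unset Strict Implicit.
Unset Printing Implicit Defensive.

Import Order.TTheory GRing.Theory Num.Theory.
Import numFieldNormedType.Exports.

Local Open Scope classical_set_scope.
Local Open Scope ring_scope.

(* 'rV[T]_n carries the product sigma-algebra, i.e. the one generated by the
   coordinates; for T = R this is the Borel sigma-algebra of R^n. *)
Definition rV_display : measure_display -> measure_display.
Proof. exact. Qed.

Section measurable_rV.
Context {d} {T : sigmaRingType d}.
Variable n : nat.

Let coord : 'I_n -> 'rV[T]_n -> T := fun i x => x ord0 i.

Let rV_set0 : g_sigma_preimage coord set0.
Proof. exact: sigma_algebra0. Qed.

Let rV_setC A : g_sigma_preimage coord A -> g_sigma_preimage coord (~` A).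
Proof. exact: sigma_algebraC. Qed.

Let rV_bigcup (F : _^nat) : (forall i, g_sigma_preimage coord (F i)) ->
  g_sigma_preimage coord (\bigcup_i (F i)).
Proof. exact: sigma_algebra_bigcup. Qed.

HB.instance Definition _ := @isMeasurable.Build (rV_display d)
  'rV[T]_n (g_sigma_preimage coord) rV_set0 rV_setC rV_bigcup.

End measurable_rV.

Lemma measurable_coord d (T : sigmaRingType d) n (i : 'I_n) :
  measurable_fun [set: 'rV[T]_n] (fun x => x ord0 i).
Proof.
move=> _ Y mY; rewrite setTI; apply: sub_sigma_algebra => /=.
rewrite -bigcup_seq/=; exists i => /=; first by rewrite mem_index_enum.
by exists Y => //; rewrite setTI.
Qed.

Lemma measurable_fun_rVP d1 d2 (T1 : measurableType d1) (T2 : measurableType d2)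
    n (f : T1 -> 'rV[T2]_n) :
  measurable_fun [set: T1] f <->
  forall i, measurable_fun [set: T1] (fun x => f x ord0 i).
Proof.
split=> [mf i|mf]; first exact: (measurableT_comp (measurable_coord i)).
move=> _ A mA; suff: preimage_set_system setT f measurable `<=` measurable.
  by apply; exists A.
have -> : preimage_set_system setT f measurable =
    g_sigma_preimage (fun i => (fun x : 'rV[T2]_n => x ord0 i) \o f).
  by rewrite g_sigma_preimage_comp.
apply: smallest_sub; first exact: sigma_algebra_measurable.
rewrite -bigcup_seq/=; apply: bigcup_sub => i _ _ [B mB <-].
exact: mf.
Qed.

Section lebesgue_rV.
Context {R : realType}.

Definition rV_cons n (p : measurableTypeR R * 'rV[R]_n) : 'rV[R]_n.+1 :=
  \row_i (if unlift ord0 i is Some j then p.2 ord0 j else p.1).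

Lemma measurable_rV_cons n : measurable_fun setT (@rV_cons n).
Proof.
apply/measurable_fun_rVP => i; case: (unliftP ord0 i) => [j|] ->.
  under eq_fun do rewrite mxE liftK.
  exact: (measurableT_comp (measurable_coord j) measurable_snd).
under eq_fun do rewrite mxE unlift_none.
exact: measurable_fst.
Qed.

Section step.
Variables (n : nat) (mu : {sigma_finite_measure set 'rV[R]_n -> \bar R}).

Definition lebesgue_rVS : set 'rV[R]_n.+1 -> \bar R :=
  pushforward (@lebesgue_measure R \x mu)%E (@rV_cons n).

HB.instance Definition _ := Measure.copy lebesgue_rVS
  (measure_function_pushforward__canonical__measure_function_Measure
    (@lebesgue_measure R \x mu)%E (@measurable_rV_cons n)).

Let lebesgue_rVS_sigma_finite : sigma_finite setT lebesgue_rVS.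
Proof.
have /sigma_finiteP[F [FT ndF Foo]] := sigma_finiteT (@lebesgue_measure R).
have /sigma_finiteP[G [GT ndG Goo]] := sigma_finiteT mu.
pose g (x : 'rV[R]_n.+1) : measurableTypeR R * 'rV[R]_n :=
  (x ord0 ord0, \row_j x ord0 (lift ord0 j)).
have gK p : g (rV_cons p) = p.
  case: p => a v; rewrite /g mxE unlift_none; congr (_, _).
  by apply/rowP => j; rewrite !mxE liftK.
have mg : measurable_fun setT g.
  apply/measurable_fun_pairP; split; first exact: (measurable_coord ord0).
  apply/measurable_fun_rVP => j /=; under eq_fun do rewrite mxE.
  exact: (measurable_coord (lift ord0 j)).
exists (fun k => g @^-1` (F k `*` G k)).
  rewrite -preimage_bigcup (_ : \bigcup_k _ = setT) ?preimage_setT//.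
  apply/seteqP; split=> // -[a v] _.
  have [i _ Fa] : (\bigcup_i F i) a by rewrite -FT.
  have [j _ Gv] : (\bigcup_i G i) v by rewrite -GT.
  exists (maxn i j) => //; split => /=.
    by move: a Fa; exact/subsetPset/ndF/leq_maxl.
  by move: v Gv; exact/subsetPset/ndG/leq_maxr.
move=> k; have [mF Fk] := Foo k; have [mG Gk] := Goo k; split.
  by rewrite -[X in measurable X]setTI; apply: mg => //; exact: measurableX.
rewrite /lebesgue_rVS /pushforward -comp_preimage.
rewrite (_ : g \o _ = id); last by apply/funext => p /=; rewrite gK.
by rewrite preimage_id product_measure1E// lte_mul_pinfty// ge0_fin_numE.
Qed.

HB.instance Definition _ := Measure_isSigmaFinite.Build _ _ _ lebesgue_rVS
  lebesgue_rVS_sigma_finite.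

End step.

(* n-dimensional Lebesgue measure on the Borel sets of R^n, as the n-fold
   product of the one-dimensional one (see [lebesgue_rV_box]). *)
Fixpoint lebesgue_rV (n : nat) : {sigma_finite_measure set 'rV[R]_n -> \bar R} :=
  if n is n'.+1 then lebesgue_rVS (lebesgue_rV n') else dirac (0 : 'rV[R]_0).

Lemma lebesgue_rV_box n (A : 'I_n -> set (measurableTypeR R)) :
  (forall i, measurable (A i)) ->
  lebesgue_rV n [set x | forall i, A i (x ord0 i)] =
  (\prod_(i < n) lebesgue_measure (A i))%E.
Proof.
elim: n A => [|n IH] A mA.
  by rewrite big_ord0 /= diracE mem_set//= => -[].
pose B := [set v : 'rV[R]_n | forall i, A (lift ord0 i) (v ord0 i)].
have mB : measurable B.
  have -> : B = \bigcap_(i in [set: 'I_n])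
      ((fun x : 'rV[R]_n => x ord0 i) @^-1` A (lift ord0 i)).
    by apply/seteqP; split=> x /= H i; [move=> _; exact: H|exact: H].
  apply: fin_bigcap_measurable => // i _.
  rewrite -[X in measurable X]setTI.
  exact: (@measurable_coord _ (measurableTypeR R) n i _ _ (mA (lift ord0 i))).
rewrite big_ord_recl -(IH (fun i => A (lift ord0 i)))// -product_measure1E//.
congr ((_ \x _)%E _); apply/seteqP; split=> -[a v] /=.
  move=> H; split; first by have := H ord0; rewrite mxE unlift_none.
  by move=> i; have := H (lift ord0 i); rewrite mxE liftK.
by move=> [Aa Av] i; rewrite mxE; case: (unliftP ord0 i) => [j|] -> //=.
Qed.

End lebesgue_rV.

Section quasi_concave.
Context {R : realType} {n : nat}.
Implicit Types (f g : 'rV[R]_n -> R) (x y z : 'rV[R]_n).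

(* The library's norm on matrices is the sup norm; this is the Euclidean one. *)
Definition enorm x : R := Num.sqrt (\sum_(i < n) x ord0 i ^+ 2).

Definition quasi_concave f := forall x y (t : R), 0 <= t <= 1 ->
  Num.min (f x) (f y) <= f (t *: x + (1 - t) *: y).

Definition upper_semicontinuous f := forall x (a : R), f x < a ->
  \forall y \near x, f y < a.

Definition vanishes_at_infinity f := forall e : R, 0 < e ->
  exists M : R, forall x, M < enorm x -> `|f x| < e.

Record QC f : Prop := {
  QC_ge0 : forall x, 0 <= f x ;
  QC_quasi_concave : quasi_concave f ;
  QC_usc : upper_semicontinuous f ;
  QC_max_le1 : forall x, f x <= 1 ;
  QC_max_attained : exists x, f x = 1 ;
  QC_vanishes : vanishes_at_infinity f }.

(* The sets whose supremum is taken are nonempty, and bounded as soon as f or g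
   is bounded above, so for QC functions [sup] is the actual supremum. *)
Definition oplus f g : 'rV[R]_n -> R := fun x =>
  sup [set r | exists y z, y + z = x /\ r = Num.min (f y) (g z)].

Definition odot (t : R) f : 'rV[R]_n -> R := fun x =>
  if t == 0 then \1_[set 0] x else f (t^-1 *: x).

(* \1_[set 0] is neutral for oplus on [0, 1]-valued functions, which justifies
   using it as the initial value of the iterated oplus. *)
Lemma oplus_indic0 f : (forall x, 0 <= f x <= 1) -> oplus f (\1_[set 0]) = f.
Proof.
move=> f01; apply/funext => x; rewrite /oplus; set S := [set r | _].
have Sub : ubound S (f x).
  move=> _ [y [z [<- ->]]]; rewrite indicE; have [z0|z0] := boolP (z \in _).
    by move: z0 => /set_mem /= ->; rewrite addr0 ge_min lexx.
  have /andP[fyz _] := f01 (y + z); by rewrite ge_min fyz orbT.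
have Sfx : S (f x).
  exists x, 0; rewrite addr0; split=> //; rewrite indicE mem_set//=.
  by rewrite min_l//; have /andP[] := f01 x.
apply/eqP; rewrite eq_le; apply/andP; split.
  by apply: ge_sup => //; exists (f x).
by apply: ub_le_sup => //; exists (f x).
Qed.

Definition oplus_sum m (f : 'I_m -> 'rV[R]_n -> R) : 'rV[R]_n -> R :=
  \big[oplus/(\1_[set 0] : 'rV[R]_n -> R)]_(i < m) f i.

End quasi_concave.

(* On the orthant, G is a homogeneous polynomial of degree n in m variables with
   coefficients in [0, +oo]: [c a] is the coefficient of the monomial with
   exponents a, whose total degree is n. Extended reals satisfy 0 * +oo = 0. *)
Definition homogeneous_polynomial {R : realType} (m n : nat)
    (G : ('I_m -> R) -> \bar R) :=
  exists c : {ffun 'I_m -> 'I_n.+1} -> \bar R,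
    (forall a, 0 <= c a)%E /\
    forall e : 'I_m -> R, (forall i, 0 <= e i) ->
      G e = (\sum_(a : {ffun 'I_m -> 'I_n.+1} | (\sum_(i < m) a i == n)%N)
               c a * (\prod_(i < m) e i ^+ a i)%:E)%E.

(* Main.v *)
(** For 0 < t <= 1 the superlevel set {F >= t} of the iterated sum is the
    Minkowski sum of the convex bodies eps_i K_i(t), K_i(t) = {f_i >= t}.  By
    Minkowski's theorem its volume is a homogeneous polynomial in eps whose
    coefficients are nonnegative and, being linear combinations of values of that
    volume, measurable in t; integrating over t (layer cake) gives the theorem.

    Minkowski's theorem is first obtained for polytopes.  A point of
    sum_i eps_i conv(A_i) is sum_j l_j a_j with l >= 0 and prescribed block sums;
    take the lexicographically least such l.  Whether l is lexicographically
    least depends only on its support, so the polytope is a disjoint union of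
    cells, one for each admissible support.  A cell is a translated linear image
    of a product of open simplices scaled by the eps_i, so that its volume is a
    nonnegative multiple of a monomial of degree n.  Convex bodies are limits of
    polytopes, and coefficients pass to the limit by interpolation. *)
From HB Require Import structures.
Require Import Defs.
From mathcomp Require Import all_boot all_order all_algebra.
From mathcomp Require Import all_classical all_reals all_analysis.
From mathcomp Require Import measurable_realfun ring lra.
Import Order.TTheory GRing.Theory Num.Theory.
Import numFieldNormedType.Exports.

Set Implicit Arguments.
Unset Strict Implicit.
Unset Printing Implicit Defensive.

Local Open Scope classical_set_scope.
Local Open Scope ring_scope.

(** * Translation invariance of Lebesgue measure *)

(** Volumes of linear images are needed only up to a finite nonnegative factor that does not depend
    on e, so uniqueness of translation-invariant measures replaces the determinant formula.

    Convex bodies are approximated from outside only: the approximating volume lies between the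
    volume of a compact set and that of a shrinking neighbourhood of it. Continuity from above then
    suffices and no estimate near the boundary enters.

    One finite family of points has to serve all e at once; otherwise the approximating volume would
    not be a polynomial in e. The approximation error is therefore kept proportional to the sum of
    the e_i.

    Cells require every e_i > 0: at e_i = 0 the support of a representation loses a whole block, and
    the monomial formula of a single cell fails. The boundary of the orthant is reached only for
    convex bodies, by continuity of the volume in e. For fixed t all coefficients are finite; the
    value +oo can appear only through the integration over t. *)

Section preimage_measures.
Context d1 d2 (T1 : measurableType d1) (T2 : measurableType d2) (R : realType).

Definition pushforward_measure (m : {measure set T1 -> \bar R}) (f : T1 -> T2)
  (mf : measurable_fun setT f) : {measure set T2 -> \bar R} :=
  measure_function_pushforward__canonical__measure_function_Measure m mf.

Lemma measurable_preimage (f : T1 -> T2) (A : set T2) :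
  measurable_fun setT f -> measurable A -> measurable (f @^-1` A).
Proof. by move=> mf mA; rewrite -[X in measurable X]setTI; exact: mf. Qed.

End preimage_measures.

Section row_vectors.
Context {R : realType}.

Lemma lebesgue_measure_translate (a : R) (A : set (measurableTypeR R)) :
  measurable A -> lebesgue_measure [set x | A (x + a)] = lebesgue_measure A.
Proof.
move=> mA.
have ma : measurable_fun setT
    ((fun x => x + a) : measurableTypeR R -> measurableTypeR R).
  exact: measurable_funD.
apply/esym; apply: (@lebesgue_measure_unique R
  (pushforward_measure lebesgue_measure ma)) => //.
move=> _ [[u v] _ <-]; rewrite /pushforward_measure/= /pushforward/=.
have -> : (fun x : R => x + a) @^-1` `]u, v]%classic = `]u - a, v - a]%classic.
  by apply/seteqP; split => x /=; rewrite !in_itv/= ltrBlDr lerBrDr.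
rewrite !lebesgue_measure_itv/= !lte_fin ltrD2r -!EFinB.
by case: ifP => // _; congr EFin; lra.
Qed.

Lemma measurable_rVD n (a : 'rV[R]_n) :
  measurable_fun setT (fun x : 'rV[R]_n => x + a).
Proof.
apply/measurable_fun_rVP => j /=; under eq_fun do rewrite mxE.
by apply: measurable_funD => //; exact: measurable_coord.
Qed.

(** Induction on the dimension: translating each factor preserves the measure of rectangles, hence
    the whole product measure by uniqueness, and [rV_cons] carries the translation [s] of pairs to
    that of vectors. *)
Lemma lebesgue_rV_translate n (a : 'rV[R]_n) (A : set 'rV[R]_n) :
  measurable A -> lebesgue_rV n [set x | A (x + a)] = lebesgue_rV n A.
Proof.
elim: n a A => [|n IH] a A mA.
  congr (lebesgue_rV 0 _); apply/seteqP.
  by split => x /=; rewrite [x]thinmx0 [a]thinmx0 addr0.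
pose a' := \row_j a ord0 (lift ord0 j).
pose s (p : measurableTypeR R * 'rV[R]_n) : measurableTypeR R * 'rV[R]_n :=
  (p.1 + a ord0 ord0, p.2 + a').
have ma0 : measurable_fun setT
    ((fun x => x + a ord0 ord0) : measurableTypeR R -> measurableTypeR R).
  exact: measurable_funD.
have ms : measurable_fun setT s.
  apply/measurable_fun_pairP; split.
    by apply: (measurableT_comp ma0); exact: measurable_fst.
  by apply: (measurableT_comp (measurable_rVD a')); exact: measurable_snd.
have E X : measurable X ->
    ((lebesgue_measure \x lebesgue_rV n) X =
     pushforward_measure (lebesgue_measure \x lebesgue_rV n) ms X)%E.
  apply: product_measure_unique => P Q mP mQ; rewrite /= /pushforward.
  have -> : s @^-1` (P `*` Q) =
    [set x | P (x + a ord0 ord0)] `*` [set x | Q (x + a')] by [].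
  have m1 : measurable [set x | P (x + a ord0 ord0)].
    exact: (measurable_preimage ma0).
  have m2 : measurable [set x | Q (x + a')].
    exact: (measurable_preimage (measurable_rVD a')).
  rewrite product_measure1E// IH//; congr (_ * _)%E.
  exact: lebesgue_measure_translate.
rewrite /lebesgue_rV -/lebesgue_rV /= /lebesgue_rVS /pushforward [RHS]E.
  congr ((_ \x _)%E _); apply/seteqP; split => -[x v] /=;
  (suff -> : rV_cons (x, v) + a = rV_cons (s (x, v)) by []);
  apply/rowP => i; rewrite !mxE;
  by case: (unliftP ord0 i) => [j|] -> //=; rewrite !mxE.
apply: measurable_preimage mA; exact: measurable_rV_cons.
Qed.

Lemma measurable_rV_box n (A : 'I_n -> set (measurableTypeR R)) :
  (forall i, measurable (A i)) ->
  measurable [set x : 'rV[R]_n | forall i, A i (x ord0 i)].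
Proof.
move=> mA; have -> : [set x : 'rV[R]_n | forall i, A i (x ord0 i)] =
    \bigcap_(i in [set: 'I_n]) ((fun x : 'rV[R]_n => x ord0 i) @^-1` A i).
  by apply/seteqP; split=> x /= H i; [move=> _; exact: H|exact: H].
apply: fin_bigcap_measurable => // i _.
exact: (@measurable_preimage _ _ _ (measurableTypeR R) _ _
  (@measurable_coord _ (measurableTypeR R) n i)).
Qed.

Lemma measurable_mulmxr n p (W : 'M[R]_(n, p)) :
  measurable_fun setT (mulmxr W : 'rV[R]_n -> 'rV[R]_p).
Proof.
apply/measurable_fun_rVP => j /=; under eq_fun do rewrite mxE.
apply: measurable_sum => i; apply: measurable_funM => //.
exact: measurable_coord.
Qed.

Lemma measurable_rVN n : measurable_fun setT (fun x : 'rV[R]_n => - x).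
Proof.
apply/measurable_fun_rVP => j /=; under eq_fun do rewrite mxE.
by apply: measurableT_comp => //; exact: measurable_coord.
Qed.

(* Tonelli applied to the indicator of {(x, y) | x in A, x + y in B}. *)
Lemma translation_invariant_swap n (mu nu : {sigma_finite_measure set 'rV[R]_n
  -> \bar R})
    (A B : set 'rV[R]_n) :
  (forall (a : 'rV[R]_n) (E : set 'rV[R]_n), measurable E ->
    mu [set x | E (x + a)] = mu E) ->
  (forall (a : 'rV[R]_n) (E : set 'rV[R]_n), measurable E ->
    nu [set x | E (x + a)] = nu E) ->
  measurable A -> measurable B ->
  (mu A * nu B = mu B * nu [set x | A (- x)%R])%E.
Proof.
move=> muT nuT mA mB.
pose S := [set p : 'rV[R]_n * 'rV[R]_n | A p.1 /\ B (p.1 + p.2)].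
have mS : measurable S.
  have -> : S = (fst @^-1` A) `&` ((fun p => p.1 + p.2) @^-1` B) by [].
  apply: measurableI; first exact: (measurable_preimage measurable_fst).
  have mf : measurable_fun setT
      (fun p : 'rV[R]_n * 'rV[R]_n => p.1 + p.2 : 'rV[R]_n).
    apply/measurable_fun_rVP => j /=; under eq_fun do rewrite mxE.
    apply: measurable_funD.
      exact: (measurableT_comp (measurable_coord j) measurable_fst).
    exact: (measurableT_comp (measurable_coord j) measurable_snd).
  exact: measurable_preimage mf mB.
have mNA : measurable [set x | A (- x)].
  exact: measurable_preimage (@measurable_rVN n) mA.
pose S' := [set p : 'rV[R]_n * 'rV[R]_n | A (p.1 - p.2) /\ B p.1].
have mS' : measurable S'.
  have -> : S' = ((fun p => p.1 - p.2) @^-1` A) `&` (fst @^-1` B) by [].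
  apply: measurableI; last exact: (measurable_preimage measurable_fst).
  have mf : measurable_fun setT
      (fun p : 'rV[R]_n * 'rV[R]_n => p.1 - p.2 : 'rV[R]_n).
    apply/measurable_fun_rVP => j /=; under eq_fun do rewrite !mxE.
    apply: measurable_funB.
      exact: (measurableT_comp (measurable_coord j) measurable_fst).
    exact: (measurableT_comp (measurable_coord j) measurable_snd).
  exact: measurable_preimage mf mA.
have tonelli (U : set ('rV[R]_n * 'rV[R]_n)) : measurable U ->
    (\int[mu]_x nu [set y | U (x, y)] = \int[nu]_y mu [set x | U (x, y)])%E.
  move=> mU.
  have := @fubini_tonelli _ _ _ _ R mu nu (fun p => (\1_U p)%:E).
  have -> : (fun x => \int[nu]_y (\1_U (x, y))%:E)%E =
            (fun x => nu [set y | U (x, y)]).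
    apply/funext => x.
    transitivity (\int[nu]_y (\1_[set y | U (x, y)] y)%:E)%E; first by [].
    rewrite integral_indic ?setIT//.
    by have := measurable_xsection x mU; rewrite xsectionE; exact.
  have -> : (fun y => \int[mu]_x (\1_U (x, y))%:E)%E =
            (fun y => mu [set x | U (x, y)]).
    apply/funext => y.
    transitivity (\int[mu]_x (\1_[set x | U (x, y)] x)%:E)%E; first by [].
    rewrite integral_indic ?setIT//.
    by have := measurable_ysection y mU; rewrite ysectionE; exact.
  apply; last by move=> p; rewrite lee_fin.
  by apply/measurable_EFinP; exact: measurable_indic.
have scale (E : set 'rV[R]_n) (k : \bar R) (g : 'rV[R]_n -> \bar R) :
    measurable E -> (0 <= k)%E -> (forall x, E x -> g x = k) ->
    (forall x, ~ E x -> g x = 0%E) -> (\int[mu]_x g x = mu E * k)%E.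
  move=> mE k0 gE g0.
  have -> : g = (fun x => k * (\1_E x)%:E)%E.
    apply/funext => x; rewrite indicE; case: (pselect (E x)) => [Ex|nEx].
      by rewrite mem_set// mule1 gE.
    by rewrite memNset// mule0 g0.
  rewrite ge0_integralZl//.
  - by rewrite integral_indic// setIT muleC.
  - by apply/measurable_EFinP; exact: measurable_indic.
have -> : (mu A * nu B = \int[mu]_x nu [set y | S (x, y)])%E.
  apply/esym/scale => // x Ax /=; last first.
    rewrite [X in nu X](_ : _ = set0) ?measure0//.
    by apply/seteqP; split => y //= -[].
  rewrite -[RHS](nuT x)//; congr (nu _).
  by apply/seteqP; split => y /=; rewrite addrC => // -[].
rewrite tonelli//.
(* Invariance of [mu] under x -> x + y moves the translation from B to A. After a second exchange of
   integrals the inner slice is a translate of -A, whose [nu]-measure is constant in x. *)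
have -> : (fun y => mu [set x | S (x, y)]) = (fun y => mu [set x | S' (x, y)]).
  apply/funext => y; have mE : measurable [set x | S' (x, y)].
    by have := measurable_ysection y mS'; rewrite ysectionE; exact.
  by rewrite -(muT y _ mE); congr (mu _); apply/seteqP; split => x /=;
    rewrite /S' /S /= addrK.
rewrite -tonelli//; apply: scale => // x Bx /=; last first.
  rewrite [X in nu X](_ : _ = set0) ?measure0//.
    by apply/seteqP; split => y //= -[].
rewrite -[RHS](nuT (- x)%R)//; congr (nu _); apply/seteqP.
by split => y /=; rewrite /S'/= opprD opprK addrC => // -[].
Qed.
End row_vectors.

(** * Linear changes of variables *)

Section linear_change.
Context {R : realType}.

Definition unit_box n : set 'rV[R]_n := [set x | forall i, 0 <= x ord0 i <= 1].

Lemma measurable_itv_box n (a b : 'I_n -> R) :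
  measurable [set x : 'rV[R]_n | forall i, a i <= x ord0 i <= b i].
Proof.
have := @measurable_rV_box R n (fun i => `[a i, b i]%classic)
  (fun i => measurable_itv _).
by under eq_set do under eq_forall do rewrite /= in_itv.
Qed.

Lemma lebesgue_rV_itv_box n (a b : 'I_n -> R) : (forall i, a i <= b i) ->
  lebesgue_rV n [set x : 'rV[R]_n | forall i, a i <= x ord0 i <= b i] =
  (\prod_(i < n) (b i - a i))%:E.
Proof.
move=> ab; have := @lebesgue_rV_box R n (fun i => `[a i, b i]%classic)
  (fun i => measurable_itv _).
under eq_set do under eq_forall do rewrite /= in_itv.
move=> ->; rewrite -prodEFin; apply: eq_bigr => i _.
rewrite lebesgue_measure_itv/= lte_fin; case: ltP => // bai.
by congr EFin; apply/esym/eqP; rewrite subr_eq0 eq_le ab bai.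
Qed.

Lemma lebesgue_rV_bounded n (E : set 'rV[R]_n) (M : R) : measurable E ->
  (forall x, E x -> forall i, `|x ord0 i| <= M) -> (lebesgue_rV n E < +oo)%E.
Proof.
move=> mE EM; pose M' := `|M|.
pose B := [set x : 'rV[R]_n | forall i, - M' <= x ord0 i <= M'].
have : (lebesgue_rV n E <= lebesgue_rV n B)%E.
  apply: le_measure; rewrite ?inE//; first exact: measurable_itv_box.
  move=> x Ex i; rewrite -ler_norml; apply: le_trans (EM x Ex i) _.
  exact: ler_norm.
move/le_lt_trans; apply; rewrite lebesgue_rV_itv_box ?ltry// => i.
by rewrite ge0_cp// normr_ge0.
Qed.

Lemma lebesgue_rV_unit_box n : lebesgue_rV n (@unit_box n) = 1%E.
Proof.
rewrite (@lebesgue_rV_itv_box n (fun=> 0) (fun=> 1))//.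
by rewrite big1// => i _; rewrite subr0.
Qed.

(** The vector x is recovered from x V by [invmx V]; summing over all its entries gives one bound
    for every coordinate. Preimages of boxes are thus bounded, hence of finite measure. *)
Lemma mulmx_unit_bound n (V : 'M[R]_n) (k : R) (x : 'rV[R]_n) :
  V \in unitmx -> 0 <= k -> (forall i, `|(x *m V) ord0 i| <= k) ->
  forall i, `|x ord0 i| <= \sum_(l < n) \sum_(j < n) k * `|invmx V j l|.
Proof.
move=> Vunit k0 xk i; rewrite -[x](mulmxK Vunit) mxE [leRHS](bigD1 i)//=.
apply: (@le_trans _ _ (\sum_j k * `|invmx V j i|)).
  apply: (le_trans (ler_norm_sum _ _ _)); apply: ler_sum => j _.
  by rewrite normrM ler_wpM2r.
by rewrite lerDl; apply: sumr_ge0 => j _; apply: sumr_ge0 => l _;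
  rewrite mulr_ge0.
Qed.

Section pushforward.
Variables (n : nat) (V : 'M[R]_n).
Hypothesis Vunit : V \in unitmx.

Let nu0 : {measure set 'rV[R]_n -> \bar R} :=
  pushforward_measure (lebesgue_rV n) (measurable_mulmxr V).

Let nu : set 'rV[R]_n -> \bar R := nu0.

HB.instance Definition _ := Measure.copy nu nu0.

Let nu_sigma_finite : sigma_finite setT nu.
Proof.
pose F (k : nat) := [set x : 'rV[R]_n | forall i, - k%:R <= x ord0 i <= k%:R].
have mF k : measurable (F k) by exact: (measurable_itv_box (fun=> - k%:R)
  (fun=> k%:R)).
exists F.
  apply/esym/seteqP; split=> // x _.
  exists (Num.bound (\sum_i `|x ord0 i|)) => // i; rewrite -ler_norml.
  apply: le_trans (ltW (archi_boundP _)); last exact: sumr_ge0.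
  by rewrite (bigD1 i)//= lerDl sumr_ge0.
move=> k; split=> //.
apply: (@lebesgue_rV_bounded _ _ (\sum_(i < n) \sum_(j < n) k%:R * `|invmx V j
  i|)).
  exact: measurable_preimage (measurable_mulmxr V) (mF k).
by move=> x /= Fx; apply: mulmx_unit_bound => // i; rewrite ler_norml Fx.
Qed.

HB.instance Definition _ := Measure_isSigmaFinite.Build _ _ _ nu
  nu_sigma_finite.

(** Both Lebesgue measure and its pushforward [nu] under V are translation invariant, hence
    proportional; the unit box, of volume 1, reveals the factor. *)
Lemma lebesgue_rV_mulmxE (E : set 'rV[R]_n) : measurable E ->
  lebesgue_rV n [set x | E (x *m V)] =
  (lebesgue_rV n [set x | @unit_box n (x *m V)] * lebesgue_rV n E)%E.
Proof.
have muT (a : 'rV[R]_n) (D : set 'rV[R]_n) : measurable D ->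
    lebesgue_rV n [set x | D (x + a)] = lebesgue_rV n D.
  exact: lebesgue_rV_translate.
have nuT (a : 'rV[R]_n) (D : set 'rV[R]_n) : measurable D ->
    nu [set x | D (x + a)] = nu D.
  move=> mD; rewrite /nu /= /pushforward.
  have mD' : measurable [set x | D (x *m V)].
    exact: measurable_preimage (measurable_mulmxr V) mD.
  rewrite -[RHS](muT (a *m invmx V) _ mD'); congr (lebesgue_rV n _).
  by apply/seteqP; split=> x /=; rewrite mulmxDl mulmxKV.
have mQ : measurable (@unit_box n) by exact: (measurable_itv_box (fun=> 0)
  (fun=> 1)).
have muQ := lebesgue_rV_unit_box n.
have NN (D : set 'rV[R]_n) : [set x | [set y | D (- y)] (- x)] = D.
  by apply/seteqP; split=> x /=; rewrite opprK.
move=> mE; have mNE : measurable [set x | E (- x)].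
  exact: measurable_preimage (@measurable_rVN R n) mE.
(* Taking both measures equal to Lebesgue measure gives its invariance under negation, which removes
   the reflection left by the second use with [nu]. *)
have := translation_invariant_swap muT muT mE mQ.
rewrite muQ mule1 mul1e => NE.
have := translation_invariant_swap muT nuT mNE mQ.
by rewrite muQ mul1e NN -NE muleC => /esym.
Qed.

End pushforward.

Lemma lebesgue_rV_mulmx n (V : 'M[R]_n) : V \in unitmx ->
  exists2 c : R, 0 <= c & forall E, measurable E ->
    lebesgue_rV n [set x | E (x *m V)] = (c%:E * lebesgue_rV n E)%E.
Proof.
move=> Vunit; pose c := lebesgue_rV n [set x | @unit_box n (x *m V)].
have mQ : measurable (@unit_box n).
  exact: (measurable_itv_box (fun=> 0) (fun=> 1)).
have c_fin : c \is a fin_num.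
  rewrite ge0_fin_numE; last exact: measure_ge0.
  apply: (@lebesgue_rV_bounded n _
    (\sum_(l < n) \sum_(j < n) 1 * `|invmx V j l|)).
    exact: measurable_preimage (measurable_mulmxr V) mQ.
  move=> x /= Qx; apply: (@mulmx_unit_bound _ V 1) => // i.
  by case/andP: (Qx i) => h0 h1; rewrite ger0_norm.
exists (fine c); first by apply: fine_ge0; exact: measure_ge0.
by move=> E mE; rewrite lebesgue_rV_mulmxE// fineK.
Qed.

(** For a diagonal matrix the preimage of the unit box is the box with sides [d i], so here the
    factor is explicit. This is the source of the monomials in e. *)
Lemma lebesgue_rV_scale n (d : 'I_n -> R) (E : set 'rV[R]_n) :
  (forall i, 0 < d i) -> measurable E ->
  lebesgue_rV n [set x | E (\row_i (x ord0 i / d i))] =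
  ((\prod_i d i)%:E * lebesgue_rV n E)%E.
Proof.
move=> d0 mE; pose V := diag_mx (\row_i (d i)^-1).
have VE x : x *m V = \row_i (x ord0 i / d i).
  by apply/rowP => i; rewrite mul_mx_diag !mxE.
have Vunit : V \in unitmx.
  rewrite unitmxE det_diag unitfE; apply/prodf_neq0 => i _.
  by rewrite mxE invr_neq0// gt_eqF.
have := lebesgue_rV_mulmxE Vunit mE.
under eq_set do rewrite VE; move=> ->; congr (_ * _)%E.
rewrite [LHS](_ : _ = lebesgue_rV n [set x | forall i, 0 <= x ord0 i <= d i]).
  rewrite lebesgue_rV_itv_box => [|i]; last exact/ltW.
  by congr EFin; apply: eq_bigr => i _; rewrite subr0.
congr (lebesgue_rV n _); apply/seteqP; split => x /= + i => /(_ i).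
all: by rewrite VE mxE ler_pdivrMr// mul1r pmulr_lge0 ?invr_gt0.
Qed.

End linear_change.

(** * Topology and measure of R^n *)

Section topology.
Context {R : realType}.

Lemma coord_le_norm n (x : 'rV[R]_n) i : `|x ord0 i| <= `|x|.
Proof.
rewrite [leRHS]/Num.norm/= mx_normrE.
exact: (le_bigmax _ (fun ij : 'I_1 * 'I_n => `|x ij.1 ij.2|) (ord0, i)).
Qed.

Lemma norm_rV_le n (x : 'rV[R]_n) (r : R) :
  0 <= r -> (forall i, `|x ord0 i| <= r) -> `|x| <= r.
Proof.
move=> r0 xr; rewrite [leLHS]/Num.norm/= mx_normrE.
by apply: bigmax_le => // -[i j] _; rewrite ord1.
Qed.

(** The sigma-algebra is generated by coordinates, so open sets must be exhausted by countably many
    boxes: those of the grids of mesh 1/(k+1) that lie inside U. *)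
Lemma open_measurable_rV n (U : set 'rV[R]_n) : open U -> measurable U.
Proof.
move=> oU.
pose box (p : nat * 'rV[int]_n) := [set x : 'rV[R]_n | forall i,
  (p.2 ord0 i)%:~R / p.1.+1%:R <= x ord0 i <=
    ((p.2 ord0 i)%:~R + 1) / p.1.+1%:R].
have -> : U = \bigcup_p (if `[< box p `<=` U >] then box p else set0).
  apply/seteqP; split=> [x Ux|x [p _]]; last by case: asboolP => // sub /sub.
  have /nbhs_ballP[e /= e0 eU] := open_nbhs_nbhs (conj oU Ux).
  pose k := Num.bound e^-1.
  have ke : k.+1%:R^-1 < e :> R.
    rewrite invf_plt ?posrE//; apply: lt_le_trans (archi_boundP _) _.
      by rewrite invr_ge0 ltW.
    by rewrite ler_nat.
  exists (k, \row_i Num.floor (x ord0 i * k.+1%:R)) => //.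
  have flo i := floor_itv (x ord0 i * k.+1%:R).
  case: asboolP => [_ i|[]].
    rewrite !mxE /= ler_pdivrMr// ler_pdivlMr//.
    by have /andP[-> /ltW] := flo i; rewrite intrD.
  move=> y yb; apply: eU; split=> // i j; rewrite ord1.
  have := yb j; rewrite mxE /= ler_pdivrMr// ler_pdivlMr// => /andP[y1 y2].
  have /andP[x1 x2] := flo j; rewrite intrD in x2.
  rewrite /ball/= ltr_norml; apply/andP.
  have : `|x ord0 j - y ord0 j| <= k.+1%:R^-1.
    rewrite -div1r ler_pdivlMr// -[X in _ * X]ger0_norm// -normrM mulrBl.
    by rewrite ler_norml; apply/andP; split; lra.
  by move/le_lt_trans => /(_ _ ke); rewrite ltr_norml => /andP.
apply: countable_bigcupT_measurable => [|p]; first exact: countableP.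
case: ifP => // _.
exact: (measurable_itv_box (fun i => (p.2 ord0 i)%:~R / p.1.+1%:R)
  (fun i => ((p.2 ord0 i)%:~R + 1) / p.1.+1%:R)).
Qed.

Lemma closed_measurable_rV n (C : set 'rV[R]_n) : closed C -> measurable C.
Proof.
move=> cC; rewrite -[C]setCK; apply: measurableC; apply: open_measurable_rV.
exact: closed_openC.
Qed.

Lemma rV_compact_closed n (C : set 'rV[R]_n) : compact C -> closed C.
Proof. by apply: compact_closed; exact: norm_hausdorff. Qed.

Lemma compact_measurable_rV n (C : set 'rV[R]_n) : compact C -> measurable C.
Proof. by move/rV_compact_closed/closed_measurable_rV. Qed.

Lemma compact_norm_bound n (C : set 'rV[R]_n) : compact C ->
  exists2 M, 0 < M & forall x, C x -> `|x| <= M.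
Proof.
move=> /compact_bounded[M [Mr CM]]; exists (`|M| + 1);
  first by rewrite ltr_wpDl.
by move=> x Cx; apply: CM => //; rewrite (le_lt_trans (ler_norm _))// ltrDl.
Qed.

Definition fatten n (C : set 'rV[R]_n) (r : R) : set 'rV[R]_n :=
  [set x | exists2 c, C c & `|x - c| < r].

Lemma fatten_open n (C : set 'rV[R]_n) r : open (fatten C r).
Proof.
rewrite (_ : fatten C r = \bigcup_(c in C) ball c r).
  by apply: bigcup_open => c _; exact: ball_open.
apply/seteqP; split=> x [c Cc]; rewrite -ball_normE/= distrC => xc;
  by exists c => //; rewrite /= -ball_normE /= // distrC.
Qed.

Lemma lebesgue_rV_bounded_norm n (E : set 'rV[R]_n) (M : R) : measurable E ->
  (forall x, E x -> `|x| <= M) -> (lebesgue_rV n E < +oo)%E.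
Proof.
move=> mE EM; apply: (@lebesgue_rV_bounded _ _ _ M) => // x Ex i.
exact: le_trans (coord_le_norm _ _) (EM _ Ex).
Qed.

Lemma lebesgue_rV_compact_fin n (C : set 'rV[R]_n) : compact C ->
  lebesgue_rV n C \is a fin_num.
Proof.
move=> cC; have [M M0 CM] := compact_norm_bound cC.
rewrite ge0_fin_numE; last exact: measure_ge0.
apply: (@lebesgue_rV_bounded_norm _ _ M) => //; exact: compact_measurable_rV.
Qed.

(** The neighbourhoods of radius 1/(k+1) decrease to C because C is closed, and have finite measure
    because C is bounded; continuity from above applies. *)
Lemma lebesgue_rV_fatten n (C : set 'rV[R]_n) (e : R) : compact C -> 0 < e ->
  exists2 r, 0 < r & (lebesgue_rV n (fatten C r) <= lebesgue_rV n C + e%:E)%E.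
Proof.
move=> cC e0; pose F (k : nat) := fatten C k.+1%:R^-1.
have mF k : measurable (F k) by apply: open_measurable_rV; exact: fatten_open.
have capF : \bigcap_k F k = C.
  apply/seteqP; split=> [x Fx|x Cx k _]; last first.
    by exists x => //; rewrite subrr normr0 invr_gt0.
  apply: (rV_compact_closed cC) => B /nbhs_ballP[d /= d0 dB].
  pose k := Num.bound d^-1.
  have kd : k.+1%:R^-1 < d :> R.
    rewrite invf_plt ?posrE//; apply: lt_le_trans (archi_boundP _) _.
      by rewrite invr_ge0 ltW.
    by rewrite ler_nat.
  have [c Cc xc] := Fx k I; exists c; split=> //; apply: dB.
  by rewrite -ball_normE /=; exact: lt_trans xc kd.
have [M M0 CM] := compact_norm_bound cC.
have F0 : (lebesgue_rV n (F 0%N) < +oo)%E.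
  apply: (@lebesgue_rV_bounded_norm _ _ (M + 1)) => // x [c Cc].
  rewrite invr1 => /ltW xc; rewrite -(subrK c x) addrC.
  by apply: le_trans (ler_normD _ _) _; apply: lerD => //; exact: CM.
have ndF : {homo F : p q / (p <= q)%N >-> (q <= p)%O}.
  move=> p q pq; apply/subsetPset => x [c Cc xc]; exists c => //.
  by apply: lt_le_trans xc _; rewrite lef_pV2 ?posrE// ler_nat.
have := @nonincreasing_cvg_mu _ _ R (lebesgue_rV n) F F0 mF.
rewrite capF => /(_ (compact_measurable_rV cC) ndF) cvgF.
have Cfin := lebesgue_rV_compact_fin cC.
have nb : nbhs (lebesgue_rV n C) [set y | (y < lebesgue_rV n C + e%:E)%E].
  apply: open_nbhs_nbhs; split; first exact: open_ereal_lt_ereal.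
  by rewrite /= lteDl// lte_fin.
have [k _ /(_ k (leqnn k))] := cvgF _ nb.
by move=> /= /ltW kC; exists k.+1%:R^-1 => //; rewrite invr_gt0.
Qed.

(** In the basis given by [row_ebase W] the row space of W is spanned by the first [\rank W] basis
    vectors. The last coordinate vanishes there, so E lies in a translated and linearly transformed
    null box. *)
Lemma lebesgue_rV_mulmx_null q n (W : 'M[R]_(q, n)) (b : 'rV[R]_n)
    (E : set 'rV[R]_n) : (\rank W < n)%N -> measurable E ->
  (forall x, E x -> exists u, x = b + u *m W) -> lebesgue_rV n E = 0%E.
Proof.
move=> rW mE EW; pose V := invmx (row_ebase W).
have Vunit : V \in unitmx by rewrite unitmx_inv row_ebase_unit.
have n0 : (0 < n)%N by apply: leq_ltn_trans rW.
pose l : 'I_n := Ordinal (n:=n) (m:=n.-1) ltac:(by rewrite prednK).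
pose A i : set (measurableTypeR R) := if i == l then [set 0] else setT.
have mA i : measurable (A i) by rewrite /A; case: ifP.
pose H := [set x : 'rV[R]_n | forall i, A i (x ord0 i)].
have mH : measurable H by exact: measurable_rV_box.
have H0 : lebesgue_rV n H = 0%E.
  rewrite /H lebesgue_rV_box// (bigD1 l)//= {1}/A eqxx.
  by rewrite lebesgue_measure_set1 mul0e.
have mE' : measurable [set x | E (x + b)].
  exact: measurable_preimage (measurable_rVD b) mE.
rewrite -(lebesgue_rV_translate b mE).
have [c c0 Hc] := lebesgue_rV_mulmx Vunit.
have mHV : measurable [set x : 'rV[R]_n | H (x *m V)].
  exact: measurable_preimage (measurable_mulmxr V) mH.
apply: (subset_measure0 mE' mHV); last by rewrite [LHS]Hc// H0 mule0.
move=> x /= /EW[u /(canRL (addrK b))]; rewrite addrAC subrr add0r => -> i.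
rewrite -(mulmx_ebase W) /V -!mulmxA mulmxV ?row_ebase_unit// mulmx1 /A.
case: eqP => // -> /=; rewrite mulmxA mxE big1// => j _.
rewrite [X in _ * X]mxE; case: (eqVneq (j : nat) l) => [->|] /=.
  by rewrite ltnNge -ltnS prednK// rW mulr0.
by rewrite mulr0.
Qed.

End topology.

(** * Polynomials and cells *)

Section homogeneous_values.
Context {R : realType} (m n : nat).
Implicit Types (e : 'I_m -> R) (V : ('I_m -> R) -> \bar R).

Definition hpoly (c : {ffun 'I_m -> 'I_n.+1} -> R) e : R :=
  \sum_(a : {ffun 'I_m -> 'I_n.+1} | (\sum_(i < m) a i == n)%N)
    c a * \prod_(i < m) e i ^+ a i.

(** Only strictly positive arguments are considered: for e_i = 0 a cell may be empty although its
    monomial does not vanish. *)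
Definition pos_hpoly V := exists2 c : {ffun 'I_m -> 'I_n.+1} -> R,
  (forall a, 0 <= c a) & forall e, (forall i, 0 < e i) -> V e = (hpoly c e)%:E.

Lemma pos_hpoly0 V : (forall e, (forall i, 0 < e i) -> V e = 0%E) ->
  pos_hpoly V.
Proof.
move=> V0; exists (fun=> 0) => // e /V0 ->.
by rewrite /hpoly big1// => a _; rewrite mul0r.
Qed.

Lemma pos_hpolyD V1 V2 : pos_hpoly V1 -> pos_hpoly V2 ->
  pos_hpoly (fun e => V1 e + V2 e)%E.
Proof.
move=> [c1 c10 H1] [c2 c20 H2]; exists (fun a => c1 a + c2 a).
  by move=> a; exact: addr_ge0.
move=> e e0; rewrite H1// H2// -EFinD; congr EFin.
by rewrite /hpoly -big_split; apply: eq_bigr => a _; rewrite mulrDl.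
Qed.

Lemma pos_hpoly_sum (I : finType) (P : pred I) (V : I -> ('I_m -> R) ->
  \bar R) :
  (forall i, P i -> pos_hpoly (V i)) ->
  pos_hpoly (fun e => \sum_(i | P i) V i e)%E.
Proof.
move=> HV; elim: (index_enum I) => [|i r IH].
  by apply: pos_hpoly0 => e _; rewrite big_nil.
under eq_fun do rewrite big_cons.
have [Pi|nPi] := boolP (P i); first by apply: pos_hpolyD => //; exact: HV.
exact: IH.
Qed.

Lemma pos_hpoly_monomial (c : R) (a : 'I_m -> nat) : 0 <= c ->
  (\sum_(i < m) a i = n)%N -> pos_hpoly (fun e => (c * \prod_i e i ^+ a i)%:E).
Proof.
move=> c0 an; have a_le i : (a i < n.+1)%N.
  by rewrite ltnS -an (bigD1 i)//= leq_addr.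
pose a' := [ffun i => Ordinal (a_le i)].
exists (fun x => if x == a' then c else 0) => [x|e _]; first by case: ifP.
rewrite /hpoly (bigD1 a') /=; last first.
  by apply/eqP; rewrite -[RHS]an; apply: eq_bigr => i _; rewrite ffunE.
rewrite eqxx [X in _ + X]big1 ?addr0; last first.
  by move=> x /andP[_ /negbTE ->]; rewrite mul0r.
by congr (_ * _)%:E; apply: eq_bigr => i _; rewrite ffunE.
Qed.

End homogeneous_values.

Section cells.
Context {R : realType} (n m : nat).

Definition block_mx_of q (b : 'I_q -> 'I_m) : 'M[R]_(q, m) :=
  \matrix_(j, i) (b j == i)%:R.

Lemma mul_block_mx_of q (b : 'I_q -> 'I_m) (u : 'rV[R]_q) i :
  (u *m block_mx_of b) ord0 i = \sum_(j | b j == i) u ord0 j.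
Proof.
rewrite mxE [RHS]big_mkcond; apply: eq_bigr => j _; rewrite mxE.
by case: eqP; rewrite ?mulr1 ?mulr0.
Qed.

(** A product over i of open simplices of size [e i]. The second inequality is strict because the
    slack is the weight of one further vertex in block i, which has to be positive. *)
Definition open_simplices q (b : 'I_q -> 'I_m) (e : 'I_m -> R) : set 'rV[R]_q :=
  [set u : 'rV[R]_q | (forall k, 0 < u ord0 k) /\
           forall i, (u *m block_mx_of b) ord0 i < e i].

Lemma measurable_open_simplices q (b : 'I_q -> 'I_m) e :
  measurable (open_simplices b e).
Proof.
have -> : open_simplices b e =
  [set u : 'rV[R]_q | forall k, `]0, +oo[%classic (u ord0 k)] `&`
  [set u : 'rV[R]_q | [set y : 'rV[R]_m | forall i, `]-oo,
    (e i)[%classic (y ord0 i)]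
     (u *m block_mx_of b)].
  apply/seteqP; split => u [] /= u1 u2; split => i.
  - by rewrite in_itv/= andbT.
  - by rewrite in_itv/=.
  - by have := u1 i; rewrite in_itv/= andbT.
  - by have := u2 i; rewrite in_itv/=.
apply: measurableI.
  by apply: (@measurable_rV_box R q (fun=> `]0, +oo[%classic)) => i.
apply: (measurable_preimage (measurable_mulmxr (block_mx_of b))).
by apply: (@measurable_rV_box R m (fun i => `]-oo, (e i)[%classic)) => i.
Qed.

(** Dividing coordinate k by [e (b k)] divides each block sum by the corresponding e_i and so
    reduces to the case where all e_i are 1. *)
Lemma lebesgue_open_simplices (b : 'I_n -> 'I_m) :
  exists2 c : R, 0 <= c & forall e, (forall i, 0 < e i) ->
    lebesgue_rV n (open_simplices b e) = (c * \prod_k e (b k))%:E.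
Proof.
pose D1 := open_simplices b (fun=> 1); pose v1 := lebesgue_rV n D1.
have mD1 : measurable D1 by exact: measurable_open_simplices.
have v1fin : v1 \is a fin_num.
  rewrite ge0_fin_numE; last exact: measure_ge0.
  apply: (@lebesgue_rV_bounded _ _ _ 1) => // u [u0 u1] k.
  have := u1 (b k); rewrite mul_block_mx_of (bigD1 k)//= => uk.
  rewrite ger0_norm ?ltW//; apply: le_lt_trans uk; rewrite lerDl.
  by apply: sumr_ge0 => j _; exact: ltW.
exists (fine v1); first by apply: fine_ge0; exact: measure_ge0.
move=> e e0; rewrite EFinM fineK// muleC -lebesgue_rV_scale//.
congr (lebesgue_rV n _); apply/seteqP.
have E (u : 'rV[R]_n) i : ((\row_k (u ord0 k / e (b k))) *m block_mx_of b) ord0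
  i =
    (u *m block_mx_of b) ord0 i / e i.
  rewrite !mul_block_mx_of mulr_suml; apply: eq_bigr => j /eqP bji.
  by rewrite mxE bji.
split => u [u1 u2]; split => k.
- by have := u1 k; rewrite mxE pmulr_lgt0// invr_gt0.
- by have := u2 k; rewrite E ltr_pdivrMr// mul1r.
- by have := u1 k; rewrite mxE pmulr_lgt0// invr_gt0.
- by have := u2 k; rewrite E ltr_pdivrMr// mul1r.
Qed.

(** The constant depends neither on e nor on the base point, and it vanishes unless q = n; this is
    what leaves only monomials of degree n. *)
Lemma lebesgue_cell q (W : 'M[R]_(q, n)) (b : 'I_q -> 'I_m) : row_free W ->
  exists c : R, [/\ 0 <= c, q != n -> c = 0 & forall e x0, (forall i,
    0 < e i) ->
    let E := [set x | exists2 u, open_simplices b e u & x = x0 + u *m W] in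
    measurable E /\ lebesgue_rV n E = (c * \prod_k e (b k))%:E].
Proof.
move=> Wfree.
have mE e x0 : measurable
    [set x | exists2 u, open_simplices b e u & x = x0 + u *m W].
  (* Measurability of an injective affine image: x belongs to it iff x - x0 is fixed by
     [pinvmx W *m W], i.e. lies in the row space, and its coordinates given by [pinvmx W] lie in the
     simplices. *)
  have -> : [set x | exists2 u, open_simplices b e u & x = x0 + u *m W] =
      [set x | [set y | open_simplices b e (y *m pinvmx W) /\
        [set z : 'rV[R]_n | forall i, [set 0] (z ord0 i)]
          (y *m (pinvmx W *m W - 1%:M))] (x + - x0)].
    apply/seteqP; split=> x /=.
      move=> [u ue ->]; rewrite addrAC subrr add0r mulmxKp//; split=> // i.
      by rewrite mulmxBr mulmx1 mulmxA mulmxKp// subrr mxE.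
    move=> [ue xW]; exists ((x - x0) *m pinvmx W) => //.
    suff /eqP : (x - x0) *m (pinvmx W *m W - 1%:M) = 0.
      by rewrite mulmxBr mulmx1 mulmxA subr_eq0 => /eqP ->; rewrite addrC subrK.
    by apply/rowP => i; rewrite xW mxE.
  apply: (measurable_preimage (measurable_rVD (- x0))); apply: measurableI.
    apply: (measurable_preimage (measurable_mulmxr (pinvmx W))).
    exact: measurable_open_simplices.
  apply: (measurable_preimage (measurable_mulmxr (pinvmx W *m W - 1%:M))).
  by apply: (@measurable_rV_box R n (fun=> [set 0])) => i.
(* Since W is row free, its rank is q <= n; for q < n the image lies in a proper affine subspace. *)
have [qn|qn] := eqVneq q n; last first.
  exists 0; split=> // e x0 e0; split; first exact: mE.
  rewrite mul0r; apply: (@lebesgue_rV_mulmx_null _ _ _ W x0) => //.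
    by rewrite ltn_neqAle rank_leq_col (eqP Wfree) qn.
  by move=> x [u _ ->]; exists u.
subst q; have Wunit : W \in unitmx by rewrite -row_free_unit.
have Vunit : invmx W \in unitmx by rewrite unitmx_inv.
have [c1 c10 H1] := lebesgue_open_simplices b.
have [c2 c20 H2] := lebesgue_rV_mulmx Vunit.
exists (c2 * c1); split; [exact: mulr_ge0|by []|move=> e x0 e0].
split; first exact: mE.
rewrite -(lebesgue_rV_translate x0)// -mulrA EFinM -H1// -H2; last first.
  exact: measurable_open_simplices.
congr (lebesgue_rV n _); apply/seteqP; split=> x /=.
  move=> [u ue /(canRL (addrK x0))]; rewrite addrAC subrr add0r => ->.
  by rewrite mulmxK.
by move=> xe; exists (x *m invmx W) => //; rewrite mulmxKV// addrC.
Qed.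

End cells.

(** * Polytopes *)

Section polytopes.
Context {R : realType}.

Definition lexpos N (d : 'rV[R]_N) : Prop :=
  exists k : 'I_N, (forall j : 'I_N, (j < k)%N -> d ord0 j = 0) /\ 0 < d ord0 k.

Lemma mulmx_continuous p q (A : 'M[R]_(p, q)) i :
  continuous (fun x : 'rV[R]_p => (x *m A) ord0 i).
Proof.
rewrite (_ : (fun _ => _) =
    (fun x : 'rV[R]_p => \sum_j x ord0 j * A j i)); last first.
  by apply/funext => x; rewrite mxE.
apply: continuous_big => [|j _]; first exact: add_continuous.
move=> x; apply: (@continuousM R _ (fun y : 'rV[R]_p => y ord0 j)).
  exact: coord_continuous.
exact: cst_continuous.
Qed.

(** The coordinates are minimised one after the other, each on the compact set where the earlier
    ones already have their minimal values. *)
Lemma lexmin_exists N (K : set 'rV[R]_N) : compact K -> K !=set0 ->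
  exists2 l, K l & forall u, K u -> u != l -> lexpos (u - l).
Proof.
move=> cK K0.
have step k : (k <= N)%N -> exists2 l, K l & forall u, K u ->
    (forall j : 'I_N, (j < k)%N -> u ord0 j = l ord0 j) \/ lexpos (u - l).
  elim: k => [|k IH] kN; first by have [l Kl] := K0; exists l => // u _; left.
  have [l Kl lmin] := IH (ltnW kN); pose i := Ordinal kN.
  pose A := [set u : 'rV[R]_N | forall j : 'I_N, (j < k)%N ->
    u ord0 j = l ord0 j].
  have cA : closed A.
    have -> : A = \bigcap_(j in [set j : 'I_N | (j < k)%N])
        ((fun u : 'rV[R]_N => u ord0 j) @^-1` [set l ord0 j]) by [].
    apply: closed_bigI => j _; apply: preimage_closed.
      by move=> u _; exact: coord_continuous.
    exact: closed_eq.
  have [l' /set_mem[Kl' Al'] l'min] : exists2 l', l' \in K `&` A &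
      forall u, u \in K `&` A -> l' ord0 i <= u ord0 i.
    apply: (@EVT_min_rV R N (fun u => u ord0 i)); first by exists l.
      exact: compact_closedI.
    by apply: continuous_subspaceT => u; exact: coord_continuous.
  exists l' => // u Ku.
  have near_l : A u ->
      (forall j : 'I_N, (j < k.+1)%N ->
        u ord0 j = l' ord0 j) \/ lexpos (u - l').
    move=> Au; have := l'min u (mem_set (conj Ku Au)).
    rewrite le_eqVlt => /orP[/eqP ul'|ul']; [left|right].
      move=> j; rewrite ltnS leq_eqVlt => /orP[/eqP ji|jk].
        by rewrite (_ : j = i) //; exact/val_inj.
      by rewrite Au// Al'.
    exists i; split=> [j jk|]; rewrite !mxE ?subr_gt0//.
    by rewrite Au// Al'// subrr.
  have [/near_l//|[h [hlt h0]]] := lmin u Ku.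
  (* If the first difference of u and l occurs at h >= k, then u still competes for the minimum of
     coordinate k; if h < k, it is also the first difference of u and l', as l' agrees with l
     there. *)
  have [kh|hk] := leqP k h.
    apply: near_l => j jk; apply/eqP; rewrite -subr_eq0.
    by have := hlt j (leq_trans jk kh); rewrite !mxE => ->.
  right; exists h; split=> [j jh|]; rewrite !mxE Al'//.
  - by have := hlt j jh; rewrite !mxE.
  - exact: ltn_trans hk.
  - by have := h0; rewrite !mxE.
have [l Kl lmin] := step N (leqnn N); exists l => // u Ku /eqP ul.
by have [ul'|//] := lmin u Ku; case: ul; apply/rowP => j; exact: ul'.
Qed.

Lemma lexpos_asym N (d : 'rV[R]_N) : lexpos d -> ~ lexpos (- d).
Proof.
move=> [k [k1 k2]] [j [j1]]; rewrite mxE oppr_gt0 => j2.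
have [jk|kj|/val_inj jk] := ltngtP j k.
- by move: j2; rewrite k1// ltxx.
- by have := j1 k kj; rewrite mxE => /eqP; rewrite oppr_eq0 gt_eqF.
- by move: j2; rewrite jk ltNge ltW.
Qed.

Lemma lexposZ N (t : R) (d : 'rV[R]_N) : 0 < t -> lexpos (t *: d) -> lexpos d.
Proof.
move=> t0 [k [k1 k2]]; exists k; split=> [j jk|].
  have /eqP := k1 j jk; rewrite mxE mulf_eq0 gt_eqF//= => /eqP //.
by move: k2; rewrite mxE pmulr_rgt0.
Qed.

Variables (n m N : nat) (v : 'M[R]_(N, n)) (b : 'I_N -> 'I_m).

(* Row j of v is a point of the block b j; [polytope e] is the Minkowski sum
   over i of e i times the convex hull of block i. *)
Definition reps (e : 'I_m -> R) (x : 'rV[R]_n) : set 'rV[R]_N :=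
  [set l : 'rV[R]_N | [/\ forall j, 0 <= l ord0 j,
    l *m block_mx_of b = \row_i e i & l *m v = x]].

Definition polytope e : set 'rV[R]_n := [set x | reps e x !=set0].

Definition row_supp (l : 'rV[R]_N) : {set 'I_N} := [set j | l ord0 j != 0]%SET.

(* A representation l admits no lexicographic improvement iff no feasible
   direction d (one with d_j >= 0 where l_j = 0) is lexicographically negative;
   this only involves the support S of l. *)
Definition lexmin_supp (S : {set 'I_N}) := forall d : 'rV[R]_N,
  d *m block_mx_of b = 0 -> d *m v = 0 ->
  (forall j, j \notin S -> 0 <= d ord0 j) -> d != 0 -> lexpos d.

Lemma reps_compact e x : compact (reps e x).
Proof.
apply: bounded_closed_compact.
  exists (\sum_i `|e i|); split; first exact: num_real.
  move=> M eM l [l0 le lx]; apply: norm_rV_le => [|j].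
    by apply: le_trans (ltW eM); exact: sumr_ge0.
  rewrite ger0_norm//; apply: le_trans (ltW eM).
  rewrite (bigD1 (b j))//=; apply: (@le_trans _ _ `|e (b j)|); last first.
    by rewrite lerDl sumr_ge0.
  apply: le_trans (ler_norm _).
  have /rowP/(_ (b j)) := le; rewrite mul_block_mx_of mxE => <-.
  by rewrite (bigD1 j)//= lerDl sumr_ge0.
have -> : reps e x = \bigcap_(j in [set: 'I_N])
      ((fun l : 'rV[R]_N => l ord0 j) @^-1` [set y | 0 <= y]) `&`
    \bigcap_(i in [set: 'I_m])
      ((fun l : 'rV[R]_N => (l *m block_mx_of b) ord0 i) @^-1` [set e i]) `&`
    \bigcap_(i in [set: 'I_n])
      ((fun l : 'rV[R]_N => (l *m v) ord0 i) @^-1` [set x ord0 i]).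
  apply/seteqP; split=> l.
    move=> [l0 le lx]; split; first split; move=> i _ //=.
      by rewrite le mxE.
    by rewrite lx.
  move=> [[l0 le] lx]; split=> [j||]; first exact: l0.
    by apply/rowP => i; rewrite [RHS]mxE; exact: le.
  by apply/rowP => i; exact: lx.
apply: closedI; first apply: closedI; apply: closed_bigI => i _;
  apply: preimage_closed.
- by move=> l _; exact: coord_continuous.
- exact: closed_ge.
- by move=> l _; exact: mulmx_continuous.
- exact: closed_eq.
- by move=> l _; exact: mulmx_continuous.
- exact: closed_eq.
Qed.

(** Let l be the least representation. A feasible direction d at l allows a step [t *: d] with t >
    0, and minimality makes that step, hence d, lexicographically positive. *)
Lemma reps_lexmin e x : reps e x !=set0 ->
  exists2 l, reps e x l & lexmin_supp (row_supp l).
Proof.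
move=> /(lexmin_exists (@reps_compact e x))[l rl lmin];
  exists l => // d db dv dS d0.
have [l0 le lx] := rl.
(* Ratio test: t is the largest step up to 1 that keeps [l + t *: d] nonnegative; the default 1
   covers the case without negative entries. *)
pose P j := d ord0 j < 0; pose F j := l ord0 j / - d ord0 j.
pose t := \big[Num.min/1]_(j | P j) F j.
have l_gt0 j : P j -> 0 < l ord0 j.
  move=> dj; rewrite lt_neqAle l0 andbT eq_sym.
  have [/dS|] := boolP (j \notin row_supp l);
    first by rewrite leNgt (dj : _ < 0).
  by rewrite negbK inE.
have t0 : 0 < t.
  by apply: lt_bigmin => // j dj; rewrite divr_gt0 ?l_gt0// oppr_gt0.
have tl j : 0 <= (l + t *: d) ord0 j.
  rewrite !mxE; have [dj|dj] := leP 0 (d ord0 j).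
    by rewrite addr_ge0// mulr_ge0// ltW.
  have : t <= F j by exact: bigmin_le_cond.
  by rewrite ler_pdivlMr ?oppr_gt0// mulrN; lra.
apply: (lexposZ t0).
rewrite (_ : t *: d = l + t *: d - l); last by rewrite addrAC subrr add0r.
apply: lmin.
  by split=> //; rewrite mulmxDl -scalemxAl ?db ?dv scaler0 addr0.
by rewrite -subr_eq0 addrAC subrr add0r scaler_eq0 negb_or gt_eqF.
Qed.

(** Otherwise u - l is feasible at l and l - u is feasible at u, so both would be lexicographically
    positive. *)
Lemma reps_lexmin_unique e x l u : reps e x l -> reps e x u ->
  lexmin_supp (row_supp l) -> lexmin_supp (row_supp u) -> l = u.
Proof.
move=> [l0 le lx] [u0 ue ux] lS uS; apply/eqP; case: eqVneq => // lu.
have supp0 (w : 'rV[R]_N) j : j \notin row_supp w -> w ord0 j = 0.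
  by rewrite inE negbK => /eqP.
have pos (w z : 'rV[R]_N) : reps e x w -> reps e x z -> w != z ->
    lexmin_supp (row_supp w) -> lexpos (z - w).
  move=> [w0 we wx] [z0 ze zx] wz; apply;
    rewrite ?mulmxBl ?we ?ze ?wx ?zx ?subrr//.
    by move=> j /supp0 wj; rewrite !mxE wj subr0.
  by rewrite subr_eq0 eq_sym.
have /lexpos_asym := pos l u (And3 l0 le lx) (And3 u0 ue ux) lu lS; case.
by rewrite opprB; apply: pos => //; rewrite eq_sym.
Qed.

Definition cell (S : {set 'I_N}) e : set 'rV[R]_n :=
  [set x | exists2 l, reps e x l & row_supp l = S].

Section full_cell.
Variables (S : {set 'I_N}) (s : 'I_m -> 'I_N).
Hypotheses (lexS : lexmin_supp S) (sS : forall i, s i \in S)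
  (bs : forall i, b (s i) = i).

(** In each block i one support index [s i] is the pivot, whose weight is determined by the block
    sum; T collects the remaining, free indices. [base e] puts all weight on the pivots, and row k
    of D moves weight from the pivot of its block to the free index [t k]. *)
Let T : {set 'I_N} := (S :\: [set s i | i in 'I_m])%SET.
Let t (k : 'I_#|T|) : 'I_N := enum_val k.
Let D : 'M[R]_(#|T|, N) :=
  \matrix_(k, j) ((j == t k)%:R - (j == s (b (t k)))%:R).
Let base e : 'rV[R]_N := \row_j \sum_i e i * (j == s i)%:R.

Let tT k : t k \in T. Proof. exact: enum_valP. Qed.

Let tS k : t k \in S. Proof. by have := tT k; rewrite inE => /andP[]. Qed.

Let t_neq_s k i : (t k == s i) = false.
Proof.
have := tT k; rewrite inE => /andP[+ _]; apply: contraNF => /eqP ->.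
exact: imset_f.
Qed.

Let s_inj i i' : (s i == s i') = (i == i').
Proof. by apply/eqP/eqP => [ss|-> //]; rewrite -(bs i) ss bs. Qed.

Let lift_t e (u : 'rV[R]_#|T|) k : (base e + u *m D) ord0 (t k) = u ord0 k.
Proof.
rewrite !mxE big1 => [|i _]; last by rewrite t_neq_s mulr0.
rewrite add0r (bigD1 k)//= mxE eqxx t_neq_s subr0 mulr1 big1 ?addr0// => j jk.
by rewrite mxE t_neq_s (inj_eq enum_val_inj) eq_sym (negbTE jk) subr0 mulr0.
Qed.

Let lift_s e (u : 'rV[R]_#|T|) i :
  (base e + u *m D) ord0 (s i) = e i - (u *m block_mx_of (b \o t)) ord0 i.
Proof.
rewrite !mxE (bigD1 i)//= eqxx mulr1 big1 ?addr0; last first.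
  by move=> j ji; rewrite s_inj eq_sym (negbTE ji) mulr0.
rewrite -sumrN; congr (_ + _); apply: eq_bigr => k _; rewrite !mxE.
by rewrite s_inj eq_sym t_neq_s sub0r mulrN eq_sym.
Qed.

Let lift_notin e (u : 'rV[R]_#|T|) j : j \notin S ->
  (base e + u *m D) ord0 j = 0.
Proof.
move=> jS; have js i : (j == s i) = false.
  by apply: contraNF jS => /eqP ->.
rewrite !mxE big1 => [|i _]; last by rewrite js mulr0.
rewrite add0r big1// => k _; rewrite mxE js.
by rewrite (_ : j == t k = false) ?subr0 ?mulr0//;
  apply: contraNF jS => /eqP ->.
Qed.

Let D_block : D *m block_mx_of b = 0 :> 'M[R]_(#|T|, m).
Proof.
apply/matrixP => k i; rewrite !mxE.
under eq_bigr => j _ do rewrite !mxE mulrBl.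
rewrite big_split /= sumrN (bigD1 (t k))//= eqxx mul1r big1 ?addr0; last first.
  by move=> j /negbTE ->; rewrite mul0r.
rewrite (bigD1 (s (b (t k))))//= eqxx mul1r big1 ?addr0 ?bs ?subrr//.
by move=> j /negbTE ->; rewrite mul0r.
Qed.

Let base_block e : base e *m block_mx_of b = \row_i e i.
Proof.
apply/rowP => i; rewrite mul_block_mx_of mxE.
under eq_bigr => j _ do rewrite mxE.
rewrite exchange_big /= (bigD1 i)//= [X in _ + X]big1 => [|i' i'i].
  rewrite addr0 (bigD1 (s i)) ?bs//= eqxx mulr1 big1 ?addr0// => j.
  by move=> /andP[_ /negbTE ->]; rewrite mulr0.
rewrite big1// => j /eqP bj; case: eqP => [js|]; rewrite ?mulr0//.
by move: i'i; rewrite -bj js bs eqxx.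
Qed.

(** The difference w vanishes off the pivots and has zero block sums; each block has exactly one
    pivot, so w vanishes there as well. *)
Let lift_uniq e (l : 'rV[R]_N) : (forall j, j \notin S -> l ord0 j = 0) ->
  l *m block_mx_of b = \row_i e i ->
  l = base e + (\row_k l ord0 (t k)) *m D.
Proof.
move=> lS le; apply/eqP; rewrite -subr_eq0; apply/eqP; set w := _ - _.
have wS j : j \notin S -> w ord0 j = 0.
  by move=> jS; rewrite /w 2!mxE lift_notin// lS// subr0.
have wT k : w ord0 (t k) = 0 by rewrite /w 2!mxE lift_t mxE subrr.
have wb : w *m block_mx_of b = 0.
  by rewrite /w mulmxBl mulmxDl -mulmxA D_block mulmx0 addr0 le base_block
    subrr.
have w0 j : j \notin [set s i | i in 'I_m]%SET -> w ord0 j = 0.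
  move=> js; have [jS|/wS//] := boolP (j \in S).
  have jT : j \in T by rewrite inE js.
  by rewrite -(enum_rankK_in jT jT) wT.
apply/rowP => j; rewrite [RHS]mxE; have [/imsetP[i _ ->]|/w0//] :=
  boolP (j \in [set s i | i in 'I_m]%SET).
have /rowP/(_ i) := wb; rewrite mul_block_mx_of mxE (bigD1 (s i)) ?bs//=.
rewrite big1 ?addr0// => j' /andP[/eqP bj' j's]; apply: w0.
by apply: contra j's => /imsetP[i' _ j'E]; rewrite j'E -bj' j'E bs.
Qed.

(** Admissibility of S yields injectivity here. If u D v = 0, then u D and -u D are both feasible
    directions, being zero off S; if nonzero, both would be lexicographically positive. So u D = 0,
    and its entries at the [t k] are those of u. *)
Let Dv_free : row_free (D *m v).
Proof.
apply: inj_row_free => u; rewrite mulmxA => uDv.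
have base0 : base (fun=> 0) = 0.
  by apply/rowP => j; rewrite !mxE big1// => i _; rewrite mul0r.
have uD0 : u *m D = 0.
  apply/eqP; case: (eqVneq (u *m D) 0) => // uD.
  have uDb : u *m D *m block_mx_of b = 0 by rewrite -mulmxA D_block mulmx0.
  have uDS j : j \notin S -> (u *m D) ord0 j = 0.
    by move=> /(lift_notin (fun=> 0) u); rewrite base0 add0r.
  have : lexpos (u *m D) by apply: lexS => // j /uDS ->.
  move/lexpos_asym; case; apply: lexS; rewrite ?mulNmx ?uDb ?uDv ?oppr0//.
    by move=> j /uDS jS; rewrite mxE jS oppr0.
  by rewrite oppr_eq0.
apply/rowP => k; rewrite -(lift_t (fun=> 0)) base0 add0r uD0 !mxE//.
Qed.

(** Positive weight at the free indices is the condition u > 0; positive weight at the pivots is the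
    strict bound on the block sums. *)
Let cellE e : cell S e =
  [set x | exists2 u, open_simplices (b \o t) e u
    & x = base e *m v + u *m (D *m v)].
Proof.
apply/seteqP; split=> x /=.
  move=> [l [l0 le lx] lS].
  have lS0 j : j \notin S -> l ord0 j = 0.
    by rewrite -lS inE negbK => /eqP.
  have lS_gt0 j : j \in S -> 0 < l ord0 j.
    by rewrite -lS inE lt_neqAle l0 eq_sym => ->.
  have lE := lift_uniq lS0 le; exists (\row_k l ord0 (t k)); last first.
    by rewrite -lx {1}lE mulmxDl mulmxA.
  split=> [k|i]; first by rewrite mxE lS_gt0.
  by rewrite -subr_gt0 -lift_s -lE lS_gt0.
move=> [u [u0 ue] ->]; pose l := base e + u *m D.
have l_gt0 j : j \in S -> 0 < l ord0 j.
  move=> jS; have [/imsetP[i _ ->]|js] :=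
    boolP (j \in [set s i | i in 'I_m]%SET).
    by rewrite lift_s subr_gt0.
  have jT : j \in T by rewrite inE js.
  by rewrite -(enum_rankK_in jT jT) lift_t.
exists l.
  split=> [j||]; last by rewrite mulmxDl mulmxA.
    have [/l_gt0/ltW//|jS] := boolP (j \in S).
    by rewrite lift_notin.
  by rewrite mulmxDl -mulmxA D_block mulmx0 addr0 base_block.
apply/setP => j; rewrite inE; have [/l_gt0|jS] := boolP (j \in S).
  by move/gt_eqF ->.
by rewrite lift_notin ?eqxx.
Qed.

(** The exponent of e_i is the number of free indices in block i, so the total degree is [#|T|]; the
    cell is null unless this equals n. *)
Lemma full_cell_hpoly :
  (forall e, (forall i, 0 < e i) -> measurable (cell S e)) /\
  pos_hpoly n (fun e => lebesgue_rV n (cell S e)).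
Proof.
have [c [c0 cn Hc]] := lebesgue_cell (b \o t) Dv_free; split.
  by move=> e e0; rewrite cellE; have [] := Hc e (base e *m v) e0.
have vol e : (forall i, 0 < e i) -> lebesgue_rV n (cell S e) =
    (c * \prod_i e i ^+ #|[set k | b (t k) == i]%SET|)%:E.
  move=> e0; rewrite cellE; have [_ ->] := Hc e (base e *m v) e0.
  congr (_ * _)%:E; rewrite (partition_big (b \o t) xpredT)//=.
  apply: eq_bigr => i _; rewrite (eq_bigr (fun=> e i)) => [|k /eqP -> //].
  by rewrite prodr_const; congr (_ ^+ _); apply: eq_card => k; rewrite !inE.
have [Tn|/cn c_eq0] := eqVneq #|T| n; last first.
  by apply: pos_hpoly0 => e /vol ->; rewrite c_eq0 mul0r.
have an : (\sum_(i < m) #|[set k | b (t k) == i]%SET| = n)%N.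
  rewrite -[RHS]Tn -[RHS]card_ord -[RHS]sum1_card (partition_big (b \o t)
    xpredT)//=.
  by apply: eq_bigr => i _; rewrite -sum1_card; apply: eq_bigl => k;
    rewrite !inE.
have [d d0 Hd] := pos_hpoly_monomial c0 an; exists d => // e e0.
by rewrite vol// -Hd.
Qed.

End full_cell.

Lemma cell_hpoly S : lexmin_supp S ->
  (forall e, (forall i, 0 < e i) -> measurable (cell S e)) /\
  pos_hpoly n (fun e => lebesgue_rV n (cell S e)).
Proof.
move=> lexS; have [full|nfull] := pselect (forall i, exists2 j,
  j \in S & b j = i).
  have [s sS] : {s : 'I_m -> 'I_N & forall i, s i \in S /\ b (s i) = i}.
    have /choice[s Hs] : forall i, exists j, j \in S /\ b j = i.
      by move=> i; have [j] := full i; exists j.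
    by exists s.
  by apply: (@full_cell_hpoly S s) => // i; have [] := sS i.
(* A support that misses block i would force the block sum [e i] to be 0, so the cell is empty for
   positive e. *)
have cell0 e : (forall i, 0 < e i) -> cell S e = set0.
  move=> e0; apply/seteqP; split=> // x [l [l0 le lx] lS]; apply: nfull => i.
  have [//|nS] := pselect (exists2 j, j \in S & b j = i).
  have := e0 i; have /rowP/(_ i) := le; rewrite mul_block_mx_of mxE => <-.
  rewrite big1 ?ltxx// => j /eqP bj; apply/eqP; apply: contra_notT nS => lj.
  by exists j => //; rewrite -lS inE.
split=> [e /cell0 ->|]; first exact: measurable0.
by apply: pos_hpoly0 => e /cell0 ->; rewrite measure0.
Qed.

(** Inadmissible supports contribute the empty set, so that unions and sums range over the finite
    type of all supports. *)
Let lexmin_cell e (S : {set 'I_N}) : set 'rV[R]_n :=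
  if `[< lexmin_supp S >] then cell S e else set0.

Let polytopeE e : polytope e = \bigcup_S lexmin_cell e S.
Proof.
apply/seteqP; split=> x.
  move=> /reps_lexmin[l rl lS]; exists (row_supp l) => //.
  by rewrite /lexmin_cell; case: asboolP => // _; exists l.
by move=> [S _]; rewrite /lexmin_cell; case: asboolP => // _ [l rl _]; exists l.
Qed.

Let measurable_lexmin_cell e S : (forall i, 0 < e i) ->
  measurable (lexmin_cell e S).
Proof.
move=> e0; rewrite /lexmin_cell; case: asboolP => // /cell_hpoly[+ _]; exact.
Qed.

Let trivIset_lexmin_cell e : trivIset [set: {set 'I_N}] (lexmin_cell e).
Proof.
move=> S1 S2 _ _ [x []]; rewrite /lexmin_cell.
case: asboolP => // lex1 [l1 r1 S1E]; case: asboolP => // lex2 [l2 r2 S2E].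
by rewrite -S1E -S2E (@reps_lexmin_unique e x l1 l2)// ?S1E ?S2E.
Qed.

Lemma measurable_polytope e : (forall i, 0 < e i) -> measurable (polytope e).
Proof.
move=> e0; rewrite polytopeE; apply: fin_bigcup_measurable => [|S _].
  exact: finite_finset.
exact: measurable_lexmin_cell.
Qed.

Lemma polytope_hpoly : pos_hpoly n (fun e => lebesgue_rV n (polytope e)).
Proof.
suff : pos_hpoly n
    (fun e => \sum_(S : {set 'I_N}) lebesgue_rV n (lexmin_cell e S))%E.
  move=> [c c0 Hc]; exists c => // e e0; rewrite -Hc// polytopeE.
  rewrite measure_fin_bigcup//; first last.
  - by move=> S _; exact: measurable_lexmin_cell.
  - exact: finite_finset.
  rewrite (fsbig_seq _ _ (index_enum_uniq _)); apply: eq_fsbigl.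
  by apply/seteqP; split=> S //= _; rewrite mem_index_enum.
apply: pos_hpoly_sum => S _; rewrite /lexmin_cell.
case: asboolP => [/cell_hpoly[]//|_].
by apply: pos_hpoly0 => e _; rewrite measure0.
Qed.

End polytopes.

(** * Limits of polynomials, sums of compact sets *)

Section hpoly_limits.
Context {R : realType} (m n : nat).
Implicit Types (c : {ffun 'I_m -> 'I_n.+1} -> R).

(** The weights are the entries of the inverse Vandermonde matrix at the nodes 1, ..., n+1. The
    nodes are positive because volumes of cells and polytopes are controlled only at positive
    arguments. *)
Lemma vandermonde_weights : exists w : 'I_n.+1 -> 'I_n.+1 -> R,
  forall l0 l, \sum_k w l0 k * (k.+1%:R : R) ^+ nat_of_ord l = (l == l0)%:R.
Proof.
pose x : 'rV[R]_n.+1 := \row_k k.+1%:R.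
pose A := Vandermonde n.+1 x.
have Aunit : A \in unitmx.
  rewrite unitmxE det_Vandermonde unitfE; apply/prodf_neq0 => i _.
  apply/prodf_neq0 => j ij; rewrite !mxE subr_eq0 eqr_nat eqSS.
  by rewrite gt_eqF.
exists (fun l0 k => invmx A k l0) => l0 l.
have := mulmxV Aunit => /matrixP/(_ l l0); rewrite !mxE => <-.
by apply: eq_bigr => k _; rewrite mulrC !mxE.
Qed.

(** The weights do not depend on the polynomial. This transfers to the coefficients any property of
    the values on a finite grid that survives linear combinations: convergence in k, and later
    measurability in t. *)
Lemma hpoly_interp : exists w : {ffun 'I_m -> 'I_n.+1} -> {ffun 'I_m ->
  'I_n.+1} -> R,
  forall c (a : {ffun 'I_m -> 'I_n.+1}), (\sum_(i < m) a i == n)%N ->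
    c a = \sum_g w a g * hpoly c (fun i => (g i).+1%:R).
Proof.
have [w1 Hw1] := vandermonde_weights.
(* Tensor product of one-variable interpolation formulas. *)
exists (fun a g => \prod_i w1 (a i) (g i)) => c a an.
have E (a' : {ffun 'I_m -> 'I_n.+1}) : \sum_(g : {ffun 'I_m -> 'I_n.+1})
    (\prod_i w1 (a i) (g i)) * (\prod_i ((g i).+1%:R : R) ^+ a' i) =
      (a' == a)%:R.
  under eq_bigr => g _ do rewrite -big_split/=.
  rewrite -(bigA_distr_bigA (fun i k => w1 (a i) k * (k.+1%:R : R) ^+ a' i)).
  under eq_bigr => i _ do rewrite Hw1.
  have [->|/eqP aa'] := eqVneq a' a; first by rewrite big1// => i _;
    rewrite eqxx.
  have [i aa'i] : exists i, a' i != a i.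
    by apply/existsP; apply: contra_notT aa'; rewrite negb_exists => /forallP H;
      apply/ffunP => i; have := H i; rewrite negbK => /eqP.
  by rewrite (bigD1 i)//= (negbTE aa'i) mul0r.
under eq_bigr => g _ do rewrite mulr_sumr.
rewrite exchange_big /= (bigD1 a)//= [X in _ + X]big1 =>
  [|a' /andP[_ /negbTE aa']].
  rewrite addr0; under eq_bigr => g _ do rewrite mulrCA.
  by rewrite -mulr_sumr E eqxx mulr1.
by under eq_bigr => g _ do rewrite mulrCA; rewrite -mulr_sumr E aa' mulr0.
Qed.

Lemma hpoly_cvg (ck : nat -> {ffun 'I_m -> 'I_n.+1} -> R) c
    (ek : nat -> 'I_m -> R) (e : 'I_m -> R) :
  (forall a : {ffun 'I_m -> 'I_n.+1}, (\sum_(i < m) a i == n)%N ->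
    ck k a @[k --> \oo] --> c a) ->
  (forall i, ek k i @[k --> \oo] --> e i) ->
  hpoly (ck k) (ek k) @[k --> \oo] --> hpoly c e.
Proof.
move=> cc ee; apply: cvg_big => [|a an]; first exact: add_continuous.
apply: cvgM; first exact: cc.
apply: cvg_big => [|i _]; first exact: mul_continuous.
have := @exprn_continuous R (a i) (e i).
by apply: (@cvg_comp _ _ _ (fun k => ek k i) (fun x : R => x ^+ a i));
  exact: ee.
Qed.

(** Convergence of the values on the grid forces convergence of the coefficients; nonnegativity
    passes to the limit, and the two limits of the values at e agree. *)
Lemma pos_hpoly_lim (Vk : nat -> ('I_m -> R) -> \bar R) (V : ('I_m -> R) ->
  \bar R) :
  (forall k, pos_hpoly n (Vk k)) ->
  (forall e, (forall i, 0 < e i) -> V e \is a fin_num /\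
     fine (Vk k e) @[k --> \oo] --> fine (V e)) ->
  pos_hpoly n V.
Proof.
move=> HVk HV.
have /choice[ck Hck] : forall k, exists c : {ffun 'I_m -> 'I_n.+1} -> R,
    (forall a, 0 <= c a) /\
    forall e, (forall i, 0 < e i) -> Vk k e = (hpoly c e)%:E.
  by move=> k; have [c] := HVk k; exists c.
have [w Hw] := hpoly_interp.
pose c (a : {ffun 'I_m -> 'I_n.+1}) : R := if (\sum_(i < m) a i == n)%N then
  \sum_g w a g * fine (V (fun i => (g i).+1%:R)) else 0.
have ckc (a : {ffun 'I_m -> 'I_n.+1}) : (\sum_(i < m) a i == n)%N ->
  ck k a @[k --> \oo] --> c a.
  move=> an; rewrite /c an; under eq_fun do rewrite (Hw _ _ an).
  apply: cvg_big => [|g _]; first exact: add_continuous.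
  apply: cvgM; first exact: cvg_cst.
  have g0 (i : 'I_m) : 0 < (g i).+1%:R :> R by [].
  have [_] := HV _ g0; apply: cvg_trans; apply: near_eq_cvg.
  by apply: nearW => k; have [_ ->] := Hck k.
exists c.
  move=> a; have [an|an] := boolP (\sum_(i < m) a i == n)%N; last first.
    by rewrite /c (negbTE an).
  apply: (cvgr_to_ge (ckc a an)); apply: nearW => k; have [+ _] := Hck k; exact.
move=> e e0; have [Vfin Vcvg] := HV e e0; rewrite -[LHS]fineK//; congr EFin.
have H1 : hpoly (ck k) e @[k --> \oo] --> hpoly c e.
  by apply: hpoly_cvg => // i; exact: cvg_cst.
apply: (cvg_unique _ _ H1); first exact: norm_hausdorff.
apply: cvg_trans Vcvg; apply: near_eq_cvg; apply: nearW => k.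
by have [_ ->] := Hck k.
Qed.

End hpoly_limits.

Section minkowski_sums.
Context {R : realType} (n : nat).
Implicit Types (A B C : set 'rV[R]_n).

Definition setsum m (A : 'I_m -> set 'rV[R]_n) : set 'rV[R]_n :=
  [set x | exists2 y : 'I_m -> 'rV[R]_n, (forall i,
    A i (y i)) & x = \sum_i y i].

Lemma setsum0 (A : 'I_0 -> set 'rV[R]_n) : setsum A = [set 0].
Proof.
apply/seteqP; split=> x; first by move=> [y _ ->]; rewrite big_ord0.
by move=> ->; exists (fun=> 0) => [[]//|]; rewrite big_ord0.
Qed.

Lemma setsum_recl m (A : 'I_m.+1 -> set 'rV[R]_n) :
  setsum A = [set x | exists y z, [/\ A ord0 y,
    setsum (fun i => A (lift ord0 i)) z & x = y + z]].
Proof.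
apply/seteqP; split=> x.
  move=> [y Ay ->]; exists (y ord0), (\sum_i y (lift ord0 i)); split=> //.
    by exists (fun i => y (lift ord0 i)).
  by rewrite big_ord_recl.
move=> [y [z [Ay [u Au ->] ->]]].
exists (fun i => if unlift ord0 i is Some j then u j else y).
  by move=> i; case: (unliftP ord0 i) => [j|] ->.
by rewrite big_ord_recl unlift_none; congr (_ + _); apply: eq_bigr => i _;
  rewrite liftK.
Qed.

Lemma compact_add A B : compact A -> compact B ->
  compact [set x | exists y z, [/\ A y, B z & x = y + z]].
Proof.
move=> cA cB.
have -> : [set x | exists y z, [/\ A y, B z & x = y + z]] =
    (fun p : 'rV[R]_n * 'rV[R]_n => p.1 + p.2) @` (A `*` B).
  apply/seteqP; split=> x.
    by move=> [y [z [Ay Bz ->]]]; exists (y, z).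
  by move=> [[y z] [Ay Bz] <-]; exists y, z.
apply: continuous_compact; last exact: compact_setX.
by apply: continuous_subspaceT; exact: add_continuous.
Qed.

Lemma compact_setsum m (A : 'I_m -> set 'rV[R]_n) :
  (forall i, compact (A i)) -> compact (setsum A).
Proof.
elim: m A => [|m IH] A cA; first by rewrite setsum0; exact: compact_set1.
rewrite setsum_recl; apply: compact_add; first exact: cA.
by apply: IH => i; exact: cA.
Qed.

Lemma compact_scale (t : R) A : compact A -> compact [set t *: y | y in A].
Proof.
move=> cA; apply: continuous_compact => //; apply: continuous_subspaceT.
exact: scaler_continuous.
Qed.

(** The squeeze is used twice: for polytopes that approximate a Minkowski sum from outside, and for
    weights e + 1/(k+1) that decrease to e. *)
Lemma cvg_fatten C (u : nat -> \bar R) (r : R) : compact C -> 0 < r ->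
  (forall k, (lebesgue_rV n C <= u k <=
    lebesgue_rV n (fatten C (r / k.+1%:R)))%E) ->
  fine (u k) @[k --> \oo] --> fine (lebesgue_rV n C).
Proof.
move=> cC r0 Cu; apply/cvgrPdist_le => eps eps0.
have [d d0 Cd] := lebesgue_rV_fatten cC eps0.
have Cfin := lebesgue_rV_compact_fin cC.
exists (Num.bound (r / d)) => // k /= kb.
have rk : r / k.+1%:R <= d.
  rewrite ler_pdivrMr// mulrC -ler_pdivrMr//; apply: ltW.
  apply: lt_le_trans (archi_boundP _) _; first by rewrite divr_ge0// ltW.
  by rewrite ler_nat leqW.
have /andP[Cuk uk] := Cu k.
have mF s : measurable (fatten C s) by apply: open_measurable_rV;
  exact: fatten_open.
have uk' : (u k <= lebesgue_rV n C + eps%:E)%E.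
  apply: le_trans uk _; apply: le_trans Cd; apply: le_measure; rewrite ?inE//.
  by move=> x [c Cc xc]; exists c => //; exact: lt_le_trans rk.
move: Cfin Cuk uk' => /fineK <-; case: (u k) => // v.
rewrite !lee_fin /= => v1 v2.
by rewrite distrC ger0_norm ?subr_ge0// lerBlDl.
Qed.

End minkowski_sums.

(** * Approximation of convex bodies by polytopes *)

Section convex_bodies.
Context {R : realType} (n : nat).
Implicit Types (K : set 'rV[R]_n).

Definition is_convex K := forall x y (t : R), K x -> K y -> 0 <= t <= 1 ->
  K (t *: x + (1 - t) *: y).

Lemma convex_comb (I : finType) K (g : I -> R) (p : I -> 'rV[R]_n) :
  is_convex K -> (forall i, 0 <= g i) -> \sum_i g i = 1 ->
  (forall i, K (p i)) -> K (\sum_i g i *: p i).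
Proof.
move=> cK g0 g1 Kp.
(* Partial sums are normalised by their total weight, so that the induction stays among convex
   combinations; total weight 0 needs a separate case. *)
suff H (r : seq I) : 0 < \sum_(i <- r) g i ->
    K ((\sum_(i <- r) g i)^-1 *: \sum_(i <- r) g i *: p i).
  by have := H (index_enum I); rewrite g1 invr1 scale1r; apply.
elim: r => [|i r IH]; first by rewrite big_nil ltxx.
rewrite !big_cons; set s := \sum_(j <- r) g j;
  set y := \sum_(j <- r) g j *: p j.
move=> gs; have s0 : 0 <= s by exact: sumr_ge0.
have [s_eq0|s_neq0] := eqVneq s 0.
  have y0 : y = 0.
    rewrite /y big_seq big1// => j jr; suff -> : g j = 0 by rewrite scale0r.
    apply/eqP; rewrite eq_le g0 andbT -s_eq0 /s (big_rem _ jr)/= lerDl.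
    exact: sumr_ge0.
  by move: gs; rewrite s_eq0 addr0 y0 addr0 => gi;
    rewrite scalerA mulVf ?gt_eqF// scale1r.
have s_gt0 : 0 < s by rewrite lt_neqAle eq_sym s_neq0.
have -> : (g i + s)^-1 *: (g i *: p i + y) =
    (g i / (g i + s)) *: p i + (1 - g i / (g i + s)) *: (s^-1 *: y).
  rewrite scalerDr !scalerA [_^-1 * g i]mulrC; congr (_ + _ *: _).
  by field; rewrite !gt_eqF.
apply: cK => //; first exact: IH.
apply/andP; split; first by rewrite divr_ge0// ltW.
by rewrite ler_pdivrMr// mul1r lerDl.
Qed.

(* The simplex with vertices -(1,...,1) and 2n e_k - (1,...,1) contains the
   unit ball of the sup norm. *)
Definition simplex_vertex (k : 'I_n.+1) : 'rV[R]_n :=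
  \row_j (if unlift ord0 k is Some k' then n%:R *+ 2 * (k' == j)%:R - 1 else -
    1).

Lemma simplex_vertex_norm k : `|simplex_vertex k| <= n%:R *+ 2 + 1.
Proof.
have n2 : 0 <= n%:R *+ 2 :> R by rewrite mulrn_wge0.
apply: norm_rV_le => [|j]; first by rewrite addr_ge0.
rewrite mxE; case: (unlift ord0 k) => [k'|];
  last by rewrite normrN normr1 lerDr.
apply: le_trans (ler_normB _ _) _; rewrite normr1 lerD2r.
by case: (k' == j); rewrite ?mulr1 ?mulr0 ?normr0 ?ger0_norm.
Qed.

Lemma simplex_vertex_cover (u : 'rV[R]_n) : (0 < n)%N -> `|u| <= 1 ->
  exists g : 'I_n.+1 -> R, [/\ forall k, 0 <= g k, \sum_k g k = 1 &
    \sum_k g k *: simplex_vertex k = u].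
Proof.
move=> n0 u1; have n2 : 0 < n%:R *+ 2 :> R by rewrite mulrn_wgt0// ltr0n.
have un j : 0 <= u ord0 j + 1 <= 2.
  have := le_trans (coord_le_norm u j) u1; rewrite ler_norml => /andP[h1 h2].
  by apply/andP; split; lra.
(* Barycentric coordinate of u at the vertex 2n e_j - (1,...,1). It is at most 1/n since u_j <= 1,
   so a nonnegative weight remains for -(1,...,1). *)
pose h (j : 'I_n) := (u ord0 j + 1) / (n%:R *+ 2).
have h0 j : 0 <= h j.
  by rewrite /h divr_ge0//; have /andP[] := un j.
have h1 : \sum_j h j <= 1.
  apply: le_trans (_ : \sum_(j < n) n%:R^-1 <= _).
    apply: ler_sum => j _; rewrite ler_pdivrMr//;
      have /andP[_ /le_trans] := un j.
    apply; rewrite mulrnAr mulVf//.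
    by rewrite pnatr_eq0 -lt0n.
  by rewrite sumr_const card_ord -[leLHS]mulr_natl mulfV// pnatr_eq0 -lt0n.
exists (fun k => if unlift ord0 k is Some j then h j else 1 - \sum_j h j);
  split.
- by move=> k; case: (unlift ord0 k) => [j|] //; rewrite subr_ge0.
- rewrite big_ord_recl unlift_none; under [X in _ + X]eq_bigr do rewrite liftK.
  by rewrite subrK.
apply/rowP => j; rewrite summxE big_ord_recl unlift_none !mxE unlift_none.
under [X in _ + X]eq_bigr do rewrite liftK !mxE liftK mulrBr mulr1.
have hj : \sum_k h k * (n%:R *+ 2 * (k == j)%:R) = u ord0 j + 1.
  rewrite (bigD1 j)//= eqxx mulr1 big1 => [|k /negbTE ->];
    last by rewrite !mulr0.
  by rewrite addr0 /h divfK// gt_eqF.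
rewrite big_split /= sumrN hj; ring.
Qed.

Lemma finite_net K (d : R) : compact K -> K !=set0 -> 0 < d ->
  exists q (a : nat -> 'rV[R]_n), (forall l, K (a l)) /\
    forall x, K x -> exists2 l, (l < q)%N & `|x - a l| < d.
Proof.
move=> cK [x0 Kx0] d0; move: (cK); rewrite compact_cover.
move=> /(_ _ K (fun c => ball c d)) [c _||D DK Kcov]; first exact: ball_open.
  by move=> x Kx; exists x => //; exact: ballxx.
pose s := finmap.enum_fset D; exists (size s), (fun l => nth x0 s l);
  split=> [l|x].
  have [ls|ls] := ltnP l (size s); last by rewrite nth_default.
  by have := DK (nth x0 s l); rewrite inE; apply; exact: mem_nth.
move=> /Kcov[c /= cD]; rewrite -ball_normE /= distrC => xc.
by exists (index c s); rewrite ?index_mem// nth_index.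
Qed.

(** The lexicographic order needs ordinal indices, whereas the approximating points are naturally
    indexed by a product type. *)
Lemma polytope_enumE m (J : finType) (P : J -> 'rV[R]_n) (b : J -> 'I_m) e x :
  polytope (\matrix_(k < #|J|) P (enum_val k)) (fun k => b (enum_val k)) e x <->
  exists g : J -> R, [/\ forall j, 0 <= g j,
    forall i, \sum_(j | b j == i) g j = e i & x = \sum_j g j *: P j].
Proof.
split=> [[l [l0 le lx]]|[g [g0 ge ->]]].
  exists (fun j => l ord0 (enum_rank j)); split=> [//|i|].
    have /rowP/(_ i) := le; rewrite mul_block_mx_of mxE => <-.
    rewrite (reindex (@enum_val J J)) /=; last exact: onW_bij (enum_val_bij J).
    by apply: eq_bigr => k _; rewrite enum_valK.
  rewrite -lx mulmx_sum_row [RHS](reindex (@enum_val J J)) /=; last first.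
    exact: onW_bij (enum_val_bij J).
  by apply: eq_bigr => k _; rewrite enum_valK rowK.
exists (\row_k g (enum_val k)); split=> [j||]; first by rewrite mxE.
  apply/rowP => i; rewrite mul_block_mx_of mxE -ge.
  rewrite [RHS](reindex (@enum_val J J)) /=;
    last exact: onW_bij (enum_val_bij J).
  by apply: eq_bigr => k _; rewrite mxE.
rewrite mulmx_sum_row [RHS](reindex (@enum_val J J)) /=; last first.
  exact: onW_bij (enum_val_bij J).
by apply: eq_bigr => k _; rewrite mxE rowK.
Qed.

Definition minkowski_sum m (K : 'I_m -> set 'rV[R]_n) (e : 'I_m -> R) :
    set 'rV[R]_n :=
  setsum (fun i => [set e i *: y | y in K i]).

Lemma minkowski_sumP m (K : 'I_m -> set 'rV[R]_n) e x :
  minkowski_sum K e x <->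
  exists2 y : 'I_m -> 'rV[R]_n, (forall i, K i (y i)) & x = \sum_i e i *: y i.
Proof.
split=> [[z Kz ->]|[y Ky ->]]; last first.
  by exists (fun i => e i *: y i) => // i; exists (y i).
have /choice[y Hy] : forall i, exists y, K i y /\ e i *: y = z i.
  by move=> i; have [y] := Kz i; exists y.
exists y => [i|]; first by have [] := Hy i.
by apply: eq_bigr => i _; have [_ ->] := Hy i.
Qed.

(** Around each point of a d-net of K_i a simplex containing the ball of radius d is placed. The
    hull of all vertices contains K_i, and replacing every vertex by its net point moves it by at
    most d (2n + 1) and leads back into K_i by convexity. The points are chosen before e. *)
Lemma polytope_approx m (K : 'I_m -> set 'rV[R]_n) (d : R) : (0 < n)%N ->
  (forall i, [/\ compact (K i), K i !=set0 & is_convex (K i)]) -> 0 < d ->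
  exists N (v : 'M[R]_(N, n)) (b : 'I_N ->
    'I_m), forall e, (forall i, 0 < e i) ->
    minkowski_sum K e `<=` polytope v b e /\
    (forall x, polytope v b e x -> exists2 c, minkowski_sum K e c &
       `|x - c| <= d * (n%:R *+ 2 + 1) * \sum_i e i).
Proof.
move=> n0 HK d0.
have /choice[q Hq] : forall i, exists q, exists (a : nat -> 'rV[R]_n),
    (forall l, K i (a l)) /\
    forall x, K i x -> exists2 l, (l < q)%N & `|x - a l| < d.
  by move=> i; have [cK K0 _] := HK i; exact: finite_net.
have {Hq} /choice[a Ha] := Hq.
(* A common bound for the sizes of all nets gives one index type; the surplus points [a i l] still
   lie in K_i. *)
pose Q := (\sum_i q i)%N.
have qQ i : (q i <= Q)%N by rewrite /Q (bigD1 i)//= leq_addr.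
pose J : finType := ('I_m * ('I_Q * 'I_n.+1))%type.
pose P (j : J) := a j.1 j.2.1 + d *: simplex_vertex j.2.2.
exists #|J|, (\matrix_(k < #|J|) P (enum_val k)), (fun k =>
  (enum_val k).1) => e e0.
have sum1 (V : zmodType) (i : 'I_m) (F : J -> V) :
    \sum_(j : J | j.1 == i) F j = \sum_(l : 'I_Q * 'I_n.+1) F (i, l).
  rewrite (reindex_onto (pair i) snd) => [|[i' l] /eqP <- //].
  by apply: eq_bigl => l; rewrite /= !eqxx.
split=> [x /minkowski_sumP[y Ky ->]|x].
  apply/(polytope_enumE P (fun j : J => j.1)).
  have /choice[g Hg] : forall i, exists g : 'I_Q * 'I_n.+1 -> R,
      [/\ forall l, 0 <= g l, \sum_l g l = 1 & \sum_l g l *: P (i, l) = y i].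
    move=> i; have [Ka /(_ _ (Ky i))[l lq yl]] := Ha i.
    have lQ : (l < Q)%N by exact: leq_trans lq (qQ i).
    have u1 : `|d^-1 *: (y i - a i l)| <= 1.
      rewrite normrZ gtr0_norm ?invr_gt0// mulrC ler_pdivrMr// mul1r;
        exact: ltW.
    have [h [h0 h1 hu]] := simplex_vertex_cover n0 u1.
    exists (fun p => if p.1 == Ordinal lQ then h p.2 else 0); split.
    - by move=> p; case: ifP.
    - rewrite -(pair_big xpredT xpredT (fun p1 p2 =>
        if p1 == Ordinal lQ then h p2 else 0))/=.
      rewrite (bigD1 (Ordinal lQ))//= [X in _ + X]big1 ?addr0 =>
        [|p /negbTE pl].
        by under eq_bigr do rewrite eqxx.
      by rewrite big1// => k _; rewrite pl.
    - rewrite -(pair_big xpredT xpredT (fun p1 p2 =>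
        (if p1 == Ordinal lQ then h p2 else 0) *: P (i, (p1, p2))))/=.
      rewrite (bigD1 (Ordinal lQ))//= [X in _ + X]big1 ?addr0 =>
        [|p /negbTE pl]; last first.
        by rewrite big1// => k _; rewrite pl scale0r.
      under eq_bigr do rewrite eqxx /P/= scalerDr scalerA mulrC -scalerA.
      rewrite big_split /= -scaler_suml h1 scale1r -scaler_sumr hu.
      by rewrite scalerA mulfV ?gt_eqF// scale1r addrC subrK.
  exists (fun j => e j.1 * g j.1 j.2); split.
  - by move=> j; apply: mulr_ge0; [exact: ltW|have [] := Hg j.1].
  - move=> i; rewrite sum1 /= -mulr_sumr; have [_ -> _] := Hg i.
    by rewrite mulr1.
  - rewrite -(pair_big xpredT xpredT (fun i l => (e i * g i l) *: P (i, l)))/=.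
    apply: eq_bigr => i _; have [_ _ <-] := Hg i; rewrite scaler_sumr.
    by apply: eq_bigr => l _; rewrite scalerA.
move=> /(polytope_enumE P (fun j : J => j.1))[g [g0 ge ->]].
(* The net points with the same weights; division by the block sum e_i > 0 turns them into a convex
   combination. *)
pose y i := (e i)^-1 *: \sum_(l : 'I_Q * 'I_n.+1) g (i, l) *: a i l.1.
have Ky i : K i (y i).
  rewrite /y scaler_sumr; under eq_bigr do rewrite scalerA.
  apply: convex_comb.
  - by have [] := HK i.
  - by move=> l; rewrite mulr_ge0// invr_ge0 ltW.
  - by rewrite -mulr_sumr -(sum1 _ i g) ge mulVf// gt_eqF.
  - by move=> l; have [+ _] := Ha i; exact.
exists (\sum_i e i *: y i); first by apply/minkowski_sumP; exists y.
have -> : \sum_i e i *: y i = \sum_j g j *: a j.1 j.2.1.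
  rewrite [RHS](eq_bigr (fun j : J => g (j.1, j.2) *: a j.1 j.2.1));
    last by case.
  rewrite -(pair_big xpredT xpredT (fun i l => g (i, l) *: a i l.1))/=.
  by apply: eq_bigr => i _; rewrite /y scalerA mulfV ?gt_eqF// scale1r.
rewrite -sumrB; apply: le_trans (ler_norm_sum _ _ _) _.
apply: le_trans (_ : \sum_j g j * (d * (n%:R *+ 2 + 1)) <= _).
  apply: ler_sum => j _; rewrite -scalerBr addrC addKr normrZ ger0_norm//.
  apply: ler_wpM2l => //; rewrite normrZ gtr0_norm//.
  by apply: ler_wpM2l; [exact: ltW|exact: simplex_vertex_norm].
rewrite -mulr_suml mulrC; apply: ler_wpM2l.
  by rewrite mulr_ge0 ?ltW// addr_gt0// mulrn_wgt0// ltr0n.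
rewrite (partition_big (fun j : J => j.1) xpredT)//=.
by apply: ler_sum => i _; rewrite ge.
Qed.

End convex_bodies.

(** * Minkowski's theorem *)

Section minkowski_theorem.
Context {R : realType} (n m : nat).
Variable K : 'I_m -> set 'rV[R]_n.
Hypothesis n0 : (0 < n)%N.
Hypothesis HK : forall i, [/\ compact (K i), K i !=set0 & is_convex (K i)].

Lemma compact_minkowski_sum e : compact (minkowski_sum K e).
Proof.
by apply: compact_setsum => i; apply: compact_scale; have [] := HK i.
Qed.

Lemma minkowski_sum_hpoly_pos :
  pos_hpoly n (fun e => lebesgue_rV n (minkowski_sum K e)).
Proof.
pose w : R := n%:R *+ 2 + 1.
have w0 : 0 < w by rewrite /w ltr_wpDl// mulrn_wge0.
(* The added 1 in the radius keeps it positive and turns the weak distance bound into the strict one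
   required by [fatten]. *)
have /choice[V HV] : forall k : nat, exists V : ('I_m -> R) -> \bar R,
    pos_hpoly n V /\ forall e, (forall i, 0 < e i) ->
    (lebesgue_rV n (minkowski_sum K e) <= V e <= lebesgue_rV n
      (fatten (minkowski_sum K e) ((w * \sum_i e i + 1) / k.+1%:R)))%E.
  move=> k; have k0 : 0 < k.+1%:R^-1 :> R by rewrite invr_gt0.
  have [N [v [b Hvb]]] := polytope_approx n0 HK k0.
  exists (fun e => lebesgue_rV n (polytope v b e)); split.
    exact: polytope_hpoly.
  move=> e e0; have [sub near] := Hvb e e0.
  have mP := measurable_polytope v b e0.
  have mC : measurable (minkowski_sum K e).
    by apply: compact_measurable_rV; exact: compact_minkowski_sum.
  apply/andP; split; apply: le_measure; rewrite ?inE//.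
    by apply: open_measurable_rV; exact: fatten_open.
  move=> x /near[c Cc xc]; exists c => //; apply: le_lt_trans xc _.
  by rewrite -mulrA mulrC ltr_pM2r// ltrDl.
apply: (pos_hpoly_lim (Vk := V)) => [k|e e0]; first by have [] := HV k.
split; first by apply: lebesgue_rV_compact_fin; exact: compact_minkowski_sum.
apply: (@cvg_fatten R n _ (V ^~ e) (w * \sum_i e i + 1)).
- exact: compact_minkowski_sum.
- apply: ltr_wpDl => //; apply: mulr_ge0; first exact: ltW.
  by apply: sumr_ge0 => i _; exact: ltW.
- by move=> k; have [_] := HV k; apply.
Qed.

Lemma minkowski_sum_hpoly : exists2 c : {ffun 'I_m -> 'I_n.+1} -> R,
  (forall a, 0 <= c a) & forall e, (forall i, 0 <= e i) ->
    lebesgue_rV n (minkowski_sum K e) = (hpoly c e)%:E.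
Proof.
(* Vanishing coordinates are reached by continuity along e + 1/(k+1). *)
have [c c0 Hc] := minkowski_sum_hpoly_pos; exists c => // e e0.
pose ek (k : nat) i := e i + k.+1%:R^-1.
have ek0 k i : 0 < ek k i by rewrite ltr_wpDl// invr_gt0.
have /choice[p Kp] : forall i, exists p, K i p.
  by move=> i; have [_ [p Kp] _] := HK i; exists p.
have /choice[M HM] : forall i, exists M, 0 < M /\ forall x, K i x -> `|x| <= M.
  move=> i; have [cK _ _] := HK i; have [M M0 KM] := compact_norm_bound cK.
  by exists M.
have cC : compact (minkowski_sum K e) by exact: compact_minkowski_sum.
rewrite -[LHS]fineK ?lebesgue_rV_compact_fin//; congr EFin.
have H1 : hpoly c (ek k) @[k --> \oo] --> hpoly c e.
  apply: hpoly_cvg => [a _|i]; first exact: cvg_cst.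
  rewrite -[X in _ --> X]addr0; apply: cvgD; first exact: cvg_cst.
  exact: cvg_harmonic.
apply: (cvg_unique _ _ H1); first exact: norm_hausdorff.
have -> : (fun k => hpoly c (ek k)) =
    (fun k => fine (lebesgue_rV n (minkowski_sum K (ek k)))).
  by apply/funext => k; rewrite Hc.
apply: (@cvg_fatten R n _ (fun k => lebesgue_rV n (minkowski_sum K (ek k)))
  (\sum_i M i + 1)) => //.
  by rewrite ltr_wpDl// sumr_ge0// => i _; have [/ltW] := HM i.
move=> k; have k0 : 0 < k.+1%:R^-1 :> R by rewrite invr_gt0.
have mC u : measurable (minkowski_sum K u).
  by apply: compact_measurable_rV; exact: compact_minkowski_sum.
apply/andP; split.
  (* As 0 need not lie in K_i, the sum for e need not be contained in the one for [ek k], but its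
     translate by z is: e_i y_i + p_i/(k+1) is [ek k i] times a convex combination of y_i and
     p_i. *)
  pose z := \sum_i k.+1%:R^-1 *: p i.
  rewrite -(lebesgue_rV_translate z (mC (ek k))); apply: le_measure;
    rewrite ?inE//.
    exact: measurable_preimage (measurable_rVD z) (mC _).
  move=> x /minkowski_sumP[y Ky ->] /=; apply/minkowski_sumP.
  pose t i := e i / ek k i.
  exists (fun i => t i *: y i + (1 - t i) *: p i).
    move=> i; have [_ _ cK] := HK i; apply: cK => //.
    apply/andP; split; first by rewrite divr_ge0// ltW.
    by rewrite ler_pdivrMr// mul1r lerDl ltW.
  rewrite -big_split; apply: eq_bigr => i _ /=.
  rewrite scalerDr !scalerA /t; congr (_ *: _ + _ *: _).
    by rewrite mulrCA mulfV ?mulr1// gt_eqF.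
  by rewrite mulrBr mulr1 mulrCA mulfV ?mulr1 ?gt_eqF// /ek addrAC subrr add0r.
apply: le_measure; rewrite ?inE//.
  by apply: open_measurable_rV; exact: fatten_open.
move=> x /minkowski_sumP[y Ky ->]; exists (\sum_i e i *: y i).
  by apply/minkowski_sumP; exists y.
rewrite -sumrB; apply: le_lt_trans (ler_norm_sum _ _ _) _.
apply: (@le_lt_trans _ _ (\sum_i k.+1%:R^-1 * M i)).
  apply: ler_sum => i _; rewrite -scalerBl /ek addrAC subrr add0r normrZ.
  rewrite gtr0_norm//; apply: ler_wpM2l; first exact: ltW.
  by have [_] := HM i; apply.
by rewrite -mulr_sumr mulrC ltr_pM2r// ltrDl.
Qed.

End minkowski_theorem.

(** * Superlevel sets and the layer-cake formula *)

Section level_sets.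
Context {R : realType} (n : nat).
Implicit Types (f g h : 'rV[R]_n -> R).

Definition superlevel f (t : R) : set 'rV[R]_n := [set x | t <= f x].

(** The property carried through the induction on the number of summands; it is stable under [oplus]
    and makes its supremum attained. *)
Definition compact_levels f := (forall x, 0 <= f x <= 1) /\
  forall t, 0 < t -> compact (superlevel f t).

(** Points of the levels s_k increasing to t have a cluster point, which lies in every closed level
    s_k. The denominator k + 2 makes already s_0 = t/2 positive. *)
Lemma superlevel_attained h (t : R) : 0 < t ->
  (forall s, 0 < s -> compact (superlevel h s)) ->
  (forall s, 0 < s < t -> superlevel h s !=set0) -> superlevel h t !=set0.
Proof.
move=> t0 cH H0; pose s (k : nat) := t - t / k.+2%:R.
have s_itv k : 0 < s k < t.
  rewrite /s subr_gt0 ltrBlDr ltrDl divr_gt0// andbT.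
  by rewrite ltr_pdivrMr// ltr_pMr// ltr1n.
have s_mono k l : (k <= l)%N -> s k <= s l.
  by move=> kl; rewrite /s lerB// ler_wpM2l ?(ltW t0)// lef_pV2 ?posrE//
    ler_nat.
have /choice[y Hy] : forall k, exists y, superlevel h (s k) y.
  by move=> k; exact: H0.
have [s00 _] := andP (s_itv 0%N).
have yK : (y @ \oo) (superlevel h (s 0%N)).
  by exists 0%N => // k _ /=; apply: le_trans (Hy k); exact: s_mono.
have [z [_ zcl]] := cH _ s00 _ _ yK.
have hz k : s k <= h z.
  have [sk0 _] := andP (s_itv k).
  apply: (rV_compact_closed (cH _ sk0)) => B Bz; apply: zcl => //.
  by exists k => // l /= kl; apply: le_trans (Hy l); exact: s_mono.
exists z; rewrite /superlevel/= leNgt; apply/negP => hzt.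
pose k := Num.bound (t / (t - h z)).
have := hz k; rewrite /s lerBlDr -lerBlDl leNgt => /negP; apply.
have th : 0 < t - h z by rewrite subr_gt0.
rewrite ltr_pdivrMr// mulrC -ltr_pdivrMr//.
apply: lt_le_trans (archi_boundP _) _; first by rewrite divr_ge0// ltW.
by rewrite ler_nat; exact: leqW (leqW (leqnn _)).
Qed.

(** Compactness of the levels of y -> min(f y, g (x - y)) makes the supremum a maximum, so that the
    level exactly t splits as a Minkowski sum. *)
Lemma superlevel_oplus f g (t : R) : compact_levels f -> compact_levels g ->
  0 < t -> superlevel (oplus f g) t =
  [set x | exists y z, [/\ superlevel f t y, superlevel g t z & x = y + z]].
Proof.
move=> [f01 cf] [g01 cg] t0; apply/seteqP; split=> x;
  rewrite /superlevel/= /oplus;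
  set S := (X in sup X) => tx.
  have S0 : S !=set0 by exists (Num.min (f x) (g 0)), x, 0; rewrite addr0.
  have Sub : has_ubound S.
    exists 1 => _ [y [z [_ ->]]]; have /andP[_ f1] := f01 y.
    by rewrite ge_min f1.
  pose h y := Num.min (f y) (g (x - y)).
  have ch s : 0 < s -> compact (superlevel h s).
    move=> s0; have -> : superlevel h s =
        superlevel f s `&` (fun y => x - y) @^-1` superlevel g s.
      by apply/seteqP; split=> y; rewrite /superlevel/= /h le_min => /andP.
    apply: compact_closedI; first exact: cf.
    apply: preimage_closed; last exact: (rV_compact_closed (cg _ s0)).
    by move=> y _; apply: continuousB; [exact: cst_continuous|exact: cvg_id].
  have h0 s : 0 < s < t -> superlevel h s !=set0.
    move=> /andP[s0 st].
    have ts : 0 < sup S - s by rewrite subr_gt0; exact: lt_le_trans tx.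
    have [_ [y [z [yz ->]]]] := sup_adherent ts (conj S0 Sub).
    rewrite opprB addrC subrK => sy; exists y.
    by rewrite /superlevel/= /h -yz addrC addKr ltW.
  have [y] := superlevel_attained t0 ch h0.
  rewrite /superlevel/= /h le_min => /andP[fy gy]; exists y, (x - y).
  by split=> //; rewrite addrC subrK.
move: tx => [y [z [fy gz xE]]].
apply: (@le_trans _ _ (Num.min (f y) (g z))); first by rewrite le_min fy gz.
apply: ub_le_sup; last by exists y, z.
exists 1 => _ [y' [z' [_ ->]]]; have /andP[_ f1] := f01 y'.
by rewrite ge_min f1.
Qed.

Lemma compact_levels_oplus f g : compact_levels f -> compact_levels g ->
  compact_levels (oplus f g).
Proof.
move=> Hf Hg; split=> [x|t t0]; last first.
  rewrite superlevel_oplus//; apply: compact_add; first by case: Hf => _; apply.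
  by case: Hg => _; apply.
have [f01 _] := Hf; have [g01 _] := Hg; rewrite /oplus; set S := (X in sup X).
have S1 : ubound S 1.
  by move=> _ [y [z [_ ->]]]; have /andP[_ f1] := f01 y; rewrite ge_min f1.
have Sx : S (Num.min (f x) (g 0)) by exists x, 0; rewrite addr0.
apply/andP; split; last by apply: ge_sup => //; exists (Num.min (f x) (g 0)).
apply: (@le_trans _ _ (Num.min (f x) (g 0))).
  by rewrite le_min; have /andP[-> _] := f01 x; have /andP[-> _] := g01 0.
by apply: ub_le_sup => //; exists 1.
Qed.

Lemma superlevel_indic0 (t : R) : 0 < t <= 1 ->
  superlevel (\1_[set 0] : 'rV[R]_n -> R) t = [set 0].
Proof.
move=> /andP[t0 t1]; apply/seteqP; split=> x; rewrite /superlevel/= indicE.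
  by case: (boolP (x \in _)) => [/set_mem //|_]; rewrite leNgt t0.
by move=> ->; rewrite mem_set.
Qed.

Lemma compact_levels_indic0 : compact_levels (\1_[set 0] : 'rV[R]_n -> R).
Proof.
split=> [x|t t0]; first by rewrite indicE; case: (_ \in _); rewrite ler01 lexx.
have [t1|t1] := leP t 1.
  by rewrite superlevel_indic0 ?t0//; exact: compact_set1.
rewrite (_ : superlevel _ _ = set0); first exact: compact0.
apply/seteqP; split=> // x; rewrite /superlevel/= leNgt => /negP; apply.
by apply: le_lt_trans t1; rewrite indicE; case: (_ \in _).
Qed.

(** The bound t <= 1 comes from the initial value of the iterated sum: above 1 the level of
    [\1_[set 0]] is empty, while the empty Minkowski sum is {0}. *)
Lemma superlevel_oplus_sum m (f : 'I_m -> 'rV[R]_n -> R) :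
  (forall i, compact_levels (f i)) -> compact_levels (oplus_sum f) /\
  forall t, 0 < t <= 1 ->
    superlevel (oplus_sum f) t = setsum (fun i => superlevel (f i) t).
Proof.
elim: m f => [|m IH] f Hf; rewrite /oplus_sum.
  rewrite big_ord0; split=> [|t t01]; first exact: compact_levels_indic0.
  by rewrite setsum0 superlevel_indic0.
rewrite big_ord_recl.
have [cI lI] := IH (fun i => f (lift ord0 i)) (fun i => Hf _).
split=> [|t t01]; first exact: compact_levels_oplus.
rewrite setsum_recl superlevel_oplus//; last by case/andP: t01.
by rewrite -lI.
Qed.

(** Vanishing at infinity gives boundedness, upper semicontinuity closedness, the attained maximum 1
    a point, and quasi-concavity convexity. *)
Lemma QC_superlevel f (t : R) : QC f -> 0 < t <= 1 ->
  [/\ compact (superlevel f t), superlevel f t !=set0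
    & is_convex (superlevel f t)].
Proof.
move=> [f0 fqc fusc f1 [x1 fx1] fv] /andP[t0 t1]; split.
- apply: bounded_closed_compact.
    have [M HM] := fv t t0; exists `|M|; split; first exact: num_real.
    move=> M' MM' x tx.
    have xM : enorm x <= M.
      rewrite leNgt; apply/negP => /HM; rewrite ger0_norm//.
      by rewrite ltNge (tx : t <= f x).
    apply: norm_rV_le => [|i]; first by rewrite ltW// (le_lt_trans _ MM').
    apply: le_trans (ltW MM'); apply: le_trans (ler_norm _); apply: le_trans xM.
    rewrite /enorm -sqrtr_sqr ler_wsqrtr// (bigD1 i)//= lerDl.
    by apply: sumr_ge0 => j _; exact: sqr_ge0.
  rewrite -[superlevel f t]setCK; apply: open_closedC.
  rewrite openE => x /= /negP; rewrite -ltNge => fx.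
  by apply: filterS (fusc _ _ fx) => y; rewrite ltNge => /negP.
- by exists x1; rewrite /superlevel/= fx1.
- move=> x y s tx ty s01; rewrite /superlevel/=;
    apply: le_trans (fqc _ _ _ s01).
  by rewrite le_min tx ty.
Qed.

Lemma superlevel_odot f (e t : R) : QC f -> 0 <= e -> 0 < t <= 1 ->
  superlevel (odot e f) t = [set e *: y | y in superlevel f t].
Proof.
move=> fQC e0 t01; rewrite /odot; have [->|e_neq0] := eqVneq e 0.
  (* For e = 0 the scaled level is {0} only because the level is nonempty. *)
  have [_ [y ty] _] := QC_superlevel fQC t01.
  rewrite (superlevel_indic0 t01); apply/seteqP; split=> x /=.
    by move=> ->; exists y => //; rewrite scale0r.
  by move=> [z _ <-]; rewrite scale0r.
apply/seteqP; split=> x; rewrite /superlevel/=.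
  by move=> tx; exists (e^-1 *: x) => //; rewrite scalerA mulfV// scale1r.
by move=> [y ty <-]; rewrite scalerA mulVf// scale1r.
Qed.

Lemma compact_levels_odot f (e : R) : QC f -> 0 <= e ->
  compact_levels (odot e f).
Proof.
move=> fQC e0; have odot01 x : 0 <= odot e f x <= 1.
  rewrite /odot; case: eqP => _; last by rewrite QC_ge0// QC_max_le1.
  by rewrite indicE; case: (_ \in _); rewrite ler01 lexx.
split=> // t t0; have [t1|t1] := leP t 1.
  have t01 : 0 < t <= 1 by rewrite t0.
  rewrite superlevel_odot//; apply: compact_scale.
  by have [] := QC_superlevel fQC t01.
rewrite (_ : superlevel _ _ = set0); first exact: compact0.
apply/seteqP; split=> // x; rewrite /superlevel/= leNgt => /negP; apply.
by apply: le_lt_trans t1; have /andP[] := odot01 x.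
Qed.

End level_sets.

Section layer_cake.
Context {R : realType} (n : nat).

(** The condition 0 < t makes the function vanish for t <= 0, so that the layer-cake integral can
    run over the whole line. *)
Definition level_volume (F : 'rV[R]_n -> R) (t : R) : \bar R :=
  lebesgue_rV n [set x | 0 < t <= F x].

Let hypograph (F : 'rV[R]_n -> R) : set ('rV[R]_n * measurableTypeR R) :=
  [set p | 0 < p.2 <= F p.1].

Let measurable_hypograph F : measurable_fun setT F -> measurable (hypograph F).
Proof.
move=> mF; have -> : hypograph F =
    (snd @^-1` `]0, +oo[%classic) `&` [set p | p.2 <= F p.1].
  apply/seteqP; split=> p; rewrite /hypograph/= in_itv/= andbT;
    first by move/andP.
  by move=> [-> ->].
apply: measurableI; first exact: (measurable_preimage measurable_snd).
rewrite -[X in measurable X]setTI; apply: measurable_fun_le => //.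
by apply: measurableT_comp mF _; exact: measurable_fst.
Qed.

Lemma measurable_compact_levels (F : 'rV[R]_n -> R) :
  compact_levels F -> measurable_fun setT F.
Proof.
move=> [F01 cF]; apply: (measurability (@RGenCInfty.G R)).
  exact: RGenCInfty.measurableE.
move=> _ [_ [t ->] <-]; rewrite setTI.
have [t0|t0] := ltP 0 t.
  apply: compact_measurable_rV; rewrite (_ : _ @^-1` _ = superlevel F t).
    exact: cF.
  by apply/seteqP; split=> x; rewrite /superlevel/= in_itv/= andbT.
rewrite (_ : _ @^-1` _ = setT); first exact: measurableT.
apply/seteqP; split=> // x _; rewrite /= in_itv/= andbT.
by apply: le_trans t0 _; have /andP[] := F01 x.
Qed.

Let hypograph_measurable_fun F : measurable_fun setT F ->
  measurable_fun setT (fun p : 'rV[R]_n * measurableTypeR R =>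
    (\1_(hypograph F) p)%:E : \bar R).
Proof.
by move=> mF; apply/measurable_EFinP; apply: measurable_indic;
  exact: measurable_hypograph.
Qed.

Let integral_hypograph F t : measurable_fun setT F ->
  (\int[lebesgue_rV n]_x (\1_(hypograph F) (x, t))%:E)%E = level_volume F t.
Proof.
move=> mF.
transitivity (\int[lebesgue_rV n]_x (\1_[set x | hypograph F (x, t)] x)%:E)%E.
  by [].
rewrite integral_indic ?setIT//.
by have := measurable_ysection t (measurable_hypograph mF); rewrite ysectionE;
  exact.
Qed.

Lemma measurable_level_volume F : measurable_fun setT F ->
  measurable_fun setT (level_volume F : measurableTypeR R -> \bar R).
Proof.
move=> mF.
have := @measurable_fun_fubini_tonelli_G _ _ _ _ R (lebesgue_rV n) _
  (hypograph_measurable_fun mF).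
rewrite /fubini_G (_ : (fun _ => _) = level_volume F); last first.
  by apply/funext => t; exact: integral_hypograph.
by apply=> p; rewrite lee_fin.
Qed.

(** Tonelli on the hypograph: its vertical section over x is []0, F x]], of length F x. *)
Lemma layer_cake (F : 'rV[R]_n -> R) : (forall x, 0 <= F x) ->
  measurable_fun setT F ->
  (\int[lebesgue_rV n]_x (F x)%:E = \int[lebesgue_measure]_t level_volume F
    t)%E.
Proof.
move=> F0 mF.
have H := @fubini_tonelli _ _ _ _ R (lebesgue_rV n) (@lebesgue_measure R) _
  (hypograph_measurable_fun mF) (fun p => ltac:(by rewrite lee_fin)).
transitivity (\int[lebesgue_rV n]_x \int[lebesgue_measure]_t
    (\1_(hypograph F) (x, t))%:E)%E.
  apply: eq_integral => x _.
  transitivity (\int[lebesgue_measure]_t (\1_(`]0%R,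
    F x]%classic : set (measurableTypeR R)) t)%:E)%E.
    transitivity (lebesgue_measure (`]0, F x]%classic : set R)).
      rewrite lebesgue_measure_itv/= lte_fin.
      by case: ltgtP (F0 x) => // [Fx|<-] _; rewrite ?sube0.
    by rewrite integral_indic// setIT.
  apply: eq_integral => t _; rewrite !indicE.
  suff -> : (t \in (`]0, F x]%classic : set (measurableTypeR R))) =
    ((x, t) \in hypograph F) by [].
  by apply/idP/idP => /set_mem tF; apply/mem_set; move: tF;
    rewrite /hypograph/= in_itv.
by rewrite H; apply: eq_integral => t _; exact: integral_hypograph.
Qed.

End layer_cake.

(** * Integration of the coefficients over the levels *)

Section volume_polynomial.
Context {R : realType} (n m : nat).
Variable f : 'I_m -> 'rV[R]_n -> R.
Hypotheses (n0 : (0 < n)%N) (fQC : forall i, QC (f i)).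

Let F (e : 'I_m -> R) := oplus_sum (fun i => odot (e i) (f i)).

Let F_levels e : (forall i, 0 <= e i) -> compact_levels (F e).
Proof.
by move=> e0; apply: (superlevel_oplus_sum _).1 => i;
  exact: compact_levels_odot.
Qed.

Let superlevel_F e t : (forall i, 0 <= e i) -> 0 < t <= 1 ->
  superlevel (F e) t = minkowski_sum (fun i => superlevel (f i) t) e.
Proof.
move=> e0 t01; have [_ ->//] := superlevel_oplus_sum
  (fun i => compact_levels_odot (fQC i) (e0 i)).
by congr setsum; apply/funext => i; exact: superlevel_odot.
Qed.

Lemma level_volume_hpoly (t : R) : exists2 c : {ffun 'I_m -> 'I_n.+1} -> R,
  (forall a, 0 <= c a) & forall e, (forall i, 0 <= e i) ->
    level_volume (F e) t = (hpoly c e)%:E.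
Proof.
have [t01|t01] := boolP (0 < t <= 1).
  have [c c0 Hc] := minkowski_sum_hpoly n0 (fun i => QC_superlevel (fQC i) t01).
  exists c => // e e0; rewrite -Hc// -superlevel_F//.
  congr (lebesgue_rV n _); apply/seteqP.
  by split=> x; rewrite /superlevel/=; case/andP: t01 => ->.
exists (fun=> 0) => // e e0; rewrite /hpoly big1 => [|a _];
  last by rewrite mul0r.
rewrite /level_volume (_ : mkset _ = set0) ?measure0//.
apply/seteqP; split=> // x /= /andP[t0 tF]; move/negP: t01; apply.
rewrite t0; apply: le_trans tF _.
by have [F01 _] := F_levels e0; have /andP[] := F01 x.
Qed.

Lemma integral_oplus_sum_homogeneous : homogeneous_polynomial n
  (fun e : 'I_m -> R => \int[lebesgue_rV n]_x (F e x)%:E)%E.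
Proof.
have /choice[ct Hct] : forall t : R, exists c : {ffun 'I_m -> 'I_n.+1} -> R,
    (forall a, 0 <= c a) /\ forall e, (forall i, 0 <= e i) ->
    level_volume (F e) t = (hpoly c e)%:E.
  by move=> t; have [c] := level_volume_hpoly t; exists c.
have [w Hw] := @hpoly_interp R m n.
have mV e : (forall i, 0 <= e i) ->
    measurable_fun setT (level_volume (F e) : measurableTypeR R -> \bar R).
  move=> e0; apply: measurable_level_volume; apply: measurable_compact_levels.
  exact: F_levels.
(* The family [ct] comes from a choice for each t, without regularity in t; interpolation expresses
   its degree-n coefficients by level volumes at fixed weights, which are measurable. *)
have mct (a : {ffun 'I_m -> 'I_n.+1}) : (\sum_(i < m) a i == n)%N ->
    measurable_fun setT ((fun t => ct t a) : measurableTypeR R -> R).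
  move=> an; under eq_fun do rewrite (Hw _ _ an).
  apply: measurable_sum => g; apply: measurable_funM => //.
  have g0 (i : 'I_m) : 0 <= (g i).+1%:R :> R by [].
  under eq_fun => t do rewrite -[hpoly _ _]/(fine (hpoly (ct t) _)%:E)
    -(proj2 (Hct t) _ g0).
  by apply: measurableT_comp (mV _ g0) => //; exact: measurable_fine.
exists (fun a : {ffun 'I_m -> 'I_n.+1} => if (\sum_(i < m) a i == n)%N then
  \int[lebesgue_measure]_t (ct t a)%:E else 0)%E; split=> [a|e e0].
  case: ifP => // _; apply: integral_ge0 => t _; rewrite lee_fin.
  by have [+ _] := Hct t; exact.
have [F01 _] := F_levels e0.
rewrite layer_cake; last 2 first.
- by move=> x; have /andP[] := F01 x.
- by apply: measurable_compact_levels; exact: F_levels.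
(* Zero terms off degree n turn the filtered sum into one over all exponents, ready for exchange
   with the integral. *)
pose T (a : {ffun 'I_m -> 'I_n.+1}) (t : measurableTypeR R) : \bar R :=
  if (\sum_(i < m) a i == n)%N then (ct t a * \prod_i e i ^+ a i)%:E else 0%E.
have prod_ge0 (a : {ffun 'I_m -> 'I_n.+1}) : 0 <= \prod_i e i ^+ a i.
  by apply: prodr_ge0 => i _; exact: exprn_ge0.
rewrite (eq_integral (fun t => \sum_a T a t)%E); last first.
  by move=> t _; rewrite (proj2 (Hct t) _ e0) /hpoly -sumEFin [LHS]big_mkcond.
rewrite ge0_integral_sum//; last 2 first.
- move=> a; rewrite /T; have [an|_] := boolP (\sum_(i < m) a i == n)%N;
    last by [].
  apply/measurable_EFinP.
  by apply: measurable_funM => //; exact: mct.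
- move=> a t _; rewrite /T; case: ifP => // _; rewrite lee_fin mulr_ge0//.
  by have [+ _] := Hct t; exact.
rewrite [RHS]big_mkcond; apply: eq_bigr => a _; rewrite /T.
have [an|an] := boolP (\sum_(i < m) a i == n)%N.
  (* The monomial is a finite nonnegative factor, so it leaves the integral even if the coefficient
     is +oo; where it vanishes, 0 times +oo is 0. *)
  under eq_integral do rewrite EFinM.
  rewrite ge0_integralZr//.
  - by apply/measurable_EFinP; exact: mct.
  - by move=> t _; rewrite lee_fin; have [+ _] := Hct t; exact.
  - by rewrite lee_fin.
exact: integral0.
Qed.

End volume_polynomial.

Theorem theorem10 (R : realType) (n m : nat) (n_ge1 : (1 <= n)%N)
    (m_ge1 : (1 <= m)%N) (f : 'I_m -> 'rV[R]_n -> R)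
    (fQC : forall i, QC (f i)) :
  homogeneous_polynomial n (fun eps : 'I_m -> R =>
    (\int[lebesgue_rV n]_x (oplus_sum (fun i => odot (eps i) (f i)) x)%:E)%E).
Proof. exact: integral_oplus_sum_homogeneous. Qed.
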